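(* Let $V$ be a superspace of dimension $(n|m)$. The subalgebra of $\mathfrak{gl}(V)$-invariant elements of $\mathfrak A^{p,q}_{k,l}=S^\bullet(U\otimes V\oplus V^*\otimes W)$ is generated by the elements $$(v_r^*,v_s)=\sum_{i\in R_V}x_{ri}x^*_{is},\qquad r\in R_U,\ s\in R_W.$$
   Context: $U$, $W$ are superspaces with $\dim U=(k|l)$, $\dim W=(p|q)$ and homogeneous bases $u_r$ ($r\in R_U=\{1,\dots,k,\bar1,\dots,\bar l\}$), $w_s$ ($s\in R_W=\{1,\dots,p,\bar1,\dots,\bar q\}$); $V$ has homogeneous basis $e_i$, $i\in R_V=\{1,\dots,n,\bar1,\dots,\bar m\}$, with $p(e_i)=0$ for unbarred and $1$ for barred indices, and $\{e_i^*\}$ is the left dual basis of $V^*$. $x_{ri}=u_r\otimes e_i$, $x^*_{is}=e^*_i\otimes w_s$. $\mathfrak{gl}(V)$ acts naturally on $V$ and $V^*$ and trivially on $U,W$, hence by derivations on $\mathfrak A^{p,q}_{k,l}$. *)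

(* Defs.v *)
From HB Require Import structures.
From mathcomp Require Import all_boot all_order all_algebra.
From mathcomp Require Import mpoly.
Set Implicit Arguments. Unset Strict Implicit. Unset Printing Implicit Defensive.
Import Order.TTheory GRing.Theory Num.Theory.
Local Open Scope ring_scope.

(** Index set of a homogeneous basis of a superspace of dimension (a|b):
    inl i  = unbarred (even) index, inr j = barred (odd) index. *)
Definition sidx (a b : nat) : finType := ('I_a + 'I_b)%type.
Definition spar (a b : nat) (i : sidx a b) : bool :=
  match i with inl _ => false | inr _ => true end.

Definition sgnF (R : nzRingType) (b : bool) : R := if b then -1 else 1.

(** * Free supercommutative algebra S(X) on a finite homogeneous basis G of a
    superspace X, with parity [par].  An element is represented by its
    expansion  sum_S  c_S * theta_S  where S ranges over the sets of odd
    generators, theta_S is the ordered product (increasing w.r.t. enum_rank)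
    of the odd generators in S, and c_S is a polynomial in the even
    generators. *)
Section SuperSym.
Variables (F : fieldType) (G : finType) (par : G -> bool).

Local Notation Ev := {x : G | ~~ par x}.
Local Notation Od := {x : G | par x}.

Definition SA := {ffun {set Od} -> {mpoly F[#|{: Ev}|]}}.

Definition sa_zero : SA := [ffun _ : {set Od} => 0].
Definition sa_add (f g : SA) : SA := [ffun S : {set Od} => f S + g S].
Definition sa_scale (c : F) (f : SA) : SA := [ffun S : {set Od} => c *: f S].
Definition sa_opp (f : SA) : SA := [ffun S : {set Od} => - f S].
Definition sa_one : SA := [ffun S : {set Od} => if S == set0 then 1 else 0].

Definition ltO (a b : Od) : bool := (enum_rank a < enum_rank b)%N.

(** theta_A * theta_B = (-1)^{#{(a,b) in A x B | b < a}} theta_(A u B) if A,B disjoint. *)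
Definition sa_mul (f g : SA) : SA :=
  [ffun S : {set Od} => \sum_(A : {set Od}) \sum_(B : {set Od} | [disjoint A & B] && (A :|: B == S))
     ((-1 : F) ^+ (\sum_(a in A) #|[set b in B | ltO b a]|)%N) *: (f A * g B)].

Definition sa_var (g : G) : SA :=
  match (insub g : option Ev) with
  | Some e => [ffun S : {set Od} => if S == set0 then 'X_(enum_rank e) else 0]
  | None => match (insub g : option Od) with
            | Some o => [ffun S : {set Od} => if S == [set o] then 1 else 0]
            | None => sa_zero
            end
  end.

(** Left (super)derivative with respect to the generator x_g. *)
Definition sa_deriv (g : G) (f : SA) : SA :=
  match (insub g : option Ev) with
  | Some e => [ffun S : {set Od} => mderiv (enum_rank e) (f S)]
  | None => match (insub g : option Od) with
            | Some o => [ffun S : {set Od} => if o \in S then 0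
                          else ((-1 : F) ^+ #|[set b in S | ltO b o]|) *: f (o |: S)]
            | None => sa_zero
            end
  end.

Definition sa_sum (I : finType) (h : I -> SA) : SA := \big[sa_add/sa_zero]_(i : I) h i.

(** The (super)derivation of S(X) sending each generator x_g to img g
    (img g homogeneous of parity par g + parity of the derivation):
    D = sum_g img(g) * d/dx_g. *)
Definition sa_der (img : G -> SA) (f : SA) : SA := sa_sum (fun g => sa_mul (img g) (sa_deriv g f)).

Inductive sa_generated (I : Type) (gens : I -> SA) : SA -> Prop :=
  | sgen_gen i : sa_generated gens (gens i)
  | sgen_one : sa_generated gens sa_one
  | sgen_add f g : sa_generated gens f -> sa_generated gens g -> sa_generated gens (sa_add f g)
  | sgen_scale c f : sa_generated gens f -> sa_generated gens (sa_scale c f)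
  | sgen_mul f g : sa_generated gens f -> sa_generated gens g -> sa_generated gens (sa_mul f g).

End SuperSym.

(** * The algebra A^{p,q}_{k,l} = S(U (x) V  (+)  V^* (x) W)
    dim U = (k|l), dim V = (n|m), dim W = (p|q).
    Generators: inl (r,i) = x_{ri} = u_r (x) e_i,  inr (i,s) = x^*_{is} = e_i^* (x) w_s. *)
Section Apq.
Variables (F : fieldType) (k l n m p q : nat).

Definition RU := sidx k l.
Definition RV := sidx n m.
Definition RW := sidx p q.

Definition Agen : finType := ((RU * RV) + (RV * RW))%type.

Definition Apar (g : Agen) : bool :=
  match g with
  | inl (r, i) => spar r (+) spar i
  | inr (i, s) => spar i (+) spar s
  end.

Definition Aalg := SA F Apar.

Definition xv (r : RU) (i : RV) : Aalg := sa_var F Apar (inl (r, i)).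
Definition xsv (i : RV) (s : RW) : Aalg := sa_var F Apar (inr (i, s)).

(** Action of the elementary matrix E_{ab} of gl(V) (E_{ab} e_c = delta_{bc} e_a)
    on the generators:  on U (x) V:  E.(u_r (x) e_i) = (-1)^{|E||u_r|} u_r (x) E e_i;
    on V^*: E.e_c^* = -(-1)^{|E||e_c^*|} e_c^* o E = -(-1)^{|E||e_a|} delta_{ca} e_b^*. *)
Definition Erho (a b : RV) (g : Agen) : Aalg :=
  let e := spar a (+) spar b in
  match g with
  | inl (r, i) => if i == b then sa_scale (sgnF F (e && spar r)) (xv r a) else sa_zero F Apar
  | inr (i, s) => if i == a then sa_scale (- sgnF F (e && spar a)) (xsv b s) else sa_zero F Apar
  end.

Definition Eact (a b : RV) (f : Aalg) : Aalg := sa_der (Erho a b) f.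

Definition glact (X : RV -> RV -> F) (f : Aalg) : Aalg :=
  sa_sum (fun ab : RV * RV => sa_scale (X ab.1 ab.2) (Eact ab.1 ab.2 f)).

Definition gl_invariant (f : Aalg) : Prop := forall X : RV -> RV -> F, glact X f = sa_zero F Apar.

Definition pairing (r : RU) (s : RW) : Aalg :=
  sa_sum (fun i : RV => sa_mul (xv r i) (xsv i s)).

End Apq.

(* Main.v *)
Require Import Defs.
From HB Require Import structures.
From mathcomp Require Import all_boot all_order all_algebra.
From mathcomp Require Import mpoly.
Set Implicit Arguments. Unset Strict Implicit. Unset Printing Implicit Defensive.
Import Order.TTheory GRing.Theory Num.Theory.
Local Open Scope ring_scope.

(** Multiplications by the generators and left derivatives make the algebra a
    module over a Weyl-Clifford algebra.  Invariance under the identity matrix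
    and characteristic zero reduce the claim to an invariant [f] of bidegree
    (d,d).  Its coefficients, for fixed words of indices in [U] and [W], form a
    kernel [K] on words of length [d] in the basis of [V]; after a sign twist
    removing the parities of [U] and [W], invariance says that [K] commutes with
    gl(V) acting on the d-th tensor power of [V].
    Such a kernel is a combination of signed permutation operators [rho]:
    by induction on the number of factors, [K] commutes with every symmetrized
    product of elementary matrices, i.e. with the sum over permutations of
    [rho E rho^-1] for each matrix unit [E].  Solving the normal equations of
    the matrix of coefficients of the [rho]'s over the rationals gives weights
    [c] such that contracting this identity with [c] leaves [K] on one side and
    a combination of [rho]'s on the other; this replaces the semisimplicity
    of the group algebra of the symmetric group.
    Finally, the element of the algebra attached to a kernel [rho] is, up to
    sign, a product of pairings. *)

(** * Words and signed operators on them *)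

(** Koszul signs are compared as boolean polynomials in the parities of letters and words; after
    generalizing these atoms a truth table decides. *)
Ltac bool_identity :=
  clear;
  repeat match goal with |- context [?f ?x] =>
    let T := type of (f x) in unify T bool;
    lazymatch f with
    | andb _ => fail | addb _ => fail | negb => fail
    | _ => generalize (f x)
    end
  end; intros;
  repeat match goal with b : bool |- _ => destruct b end; reflexivity.

Section Signed.
Variable M : zmodType.
Implicit Types (b c : bool) (u v : M).

(** The exponent of the sign is kept as a boolean, so that composing signs is [addb] and every sign
    check becomes a boolean identity. *)
Definition signed b v : M := if b then - v else v.

Lemma signedA b c v : signed b (signed c v) = signed (b (+) c) v.
Proof. by case: b; case: c => //=; rewrite opprK. Qed.

Lemma signedD b u v : signed b (u + v) = signed b u + signed b v.
Proof. by case: b; rewrite //= opprD. Qed.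

Lemma signed0 b : signed b 0 = 0.
Proof. by case: b; rewrite //= oppr0. Qed.

Lemma signed_sum b (I : Type) (r : seq I) (P : pred I) (f : I -> M) :
  signed b (\sum_(i <- r | P i) f i) = \sum_(i <- r | P i) signed b (f i).
Proof. by case: b => //=; rewrite sumrN. Qed.

Lemma signedI b u v : signed b u = signed b v -> u = v.
Proof. by case: b => //= /oppr_inj. Qed.

Lemma signed_if b c v : signed b (if c then v else 0) = if c then signed b v else 0.
Proof. by case: c; rewrite ?signed0. Qed.
End Signed.

Lemma linear_signed (R : pzRingType) (M N : lmodType R) (f : {linear M -> N}) b v :
  f (signed b v) = signed b (f v).
Proof. by case: b; rewrite //= linearN. Qed.

Lemma signedZr (R : pzRingType) (M : lmodType R) (k : R) b (v : M) :
  k *: signed b v = signed b (k *: v).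
Proof. by case: b; rewrite //= scalerN. Qed.

Lemma signedZl (R : pzRingType) (M : lmodType R) (k : R) b (v : M) :
  signed b k *: v = signed b (k *: v).
Proof. by case: b; rewrite //= scaleNr. Qed.

Lemma sum_tuple_cons (T : finType) (M : zmodType) n (h : seq T -> M) :
  \sum_(w : n.+1.-tuple T) h w = \sum_x \sum_(w : n.-tuple T) h (x :: w).
Proof.
rewrite pair_bigA (reindex (fun u : T * n.-tuple T => [tuple of u.1 :: u.2])) //=.
exists (fun w => (thead w, [tuple of behead w])) => [[x w]|w] _ /=.
  by congr (_, _); apply/val_inj.
by rewrite [RHS]tuple_eta; apply/val_inj.
Qed.

Lemma sum_tuple_nil (T : finType) (M : zmodType) (h : seq T -> M) :
  \sum_(w : 0.-tuple T) h w = h [::].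
Proof.
rewrite (big_pred1 [tuple]) // => w.
by rewrite (tuple0 w) /= eqxx.
Qed.

Section Words.
Variables (V : finType) (p : V -> bool).
Implicit Types (j : seq V) (a c x y : V) (n t : nat) (M N : zmodType).

Definition psum j := foldr (fun x b => p x (+) b) false j.

(* Elementary matrix [E_ac] acting at tensor position [n]; the Koszul sign is
   read off from the letters on its right. *)
Fixpoint sl M n a c (v : seq V -> M) j {struct j} : M :=
  match j with
  | [::] => 0
  | x :: j' =>
    match n with
    | 0 => if x == a then signed ((p a (+) p c) && psum j') (v (c :: j')) else 0
    | n'.+1 => sl n' a c (fun i => v (x :: i)) j'
    end
  end.

Lemma sl_ext M n a c (v v' : seq V -> M) j :
  (forall i, size i = size j -> v i = v' i) -> sl n a c v j = sl n a c v' j.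
Proof.
elim: j n v v' => //= x j IH [|n] v v' e; first by rewrite e.
by apply: IH => i si; rewrite e //= si.
Qed.

Lemma sl_morph M N (f : M -> N) n a c (v : seq V -> M) j :
  f 0 = 0 -> {morph f : x / - x} ->
  f (sl n a c v j) = sl n a c (fun i => f (v i)) j.
Proof.
move=> f0 fN; elim: j n v => //= x j IH [|n] v; last by rewrite IH.
by rewrite (fun_if f) f0; congr (if _ then _ else _); case: (_ && _); rewrite //= fN.
Qed.

Lemma slD M n a c (v v' : seq V -> M) j :
  sl n a c (fun i => v i + v' i) j = sl n a c v j + sl n a c v' j.
Proof.
elim: j n v v' => [|x j IH] [|n] v v' /=; rewrite ?addr0 //.
by rewrite signedD; case: ifP => _; rewrite ?addr0.
Qed.

Lemma sl0 M n a c j : sl n a c (fun _ => 0 : M) j = 0.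
Proof. by elim: j n => //= x j IH [|n] //; rewrite signed0 if_same. Qed.

Lemma sl_sum M n a c (I : Type) (r : seq I) (P : pred I) (v : I -> seq V -> M) j :
  sl n a c (fun i => \sum_(k <- r | P k) v k i) j = \sum_(k <- r | P k) sl n a c (v k) j.
Proof.
elim: r => [|k r IH].
  rewrite big_nil -[RHS](sl0 M n a c j); apply: sl_ext => i _; by rewrite big_nil.
rewrite big_cons -IH; case Pk: (P k).
  by rewrite -slD; apply: sl_ext => i _; rewrite big_cons Pk.
by apply: sl_ext => i _; rewrite big_cons Pk.
Qed.

Lemma sl_signed M n a c b (v : seq V -> M) j :
  sl n a c (fun i => signed b (v i)) j = signed b (sl n a c v j).
Proof.
symmetry; apply: (sl_morph (f := signed b)); first exact: signed0.
by move=> x; case: (b).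
Qed.

(** Replacing one letter [a] by [c] shifts the parity of the whole word by [p a (+) p c], so a
    parity twist passes through up to a fixed sign. *)
Lemma sl_psum M n a c e (v : seq V -> M) j :
  sl n a c (fun i => signed (e && psum i) (v i)) j
  = signed (e && (psum j (+) p a (+) p c)) (sl n a c v j).
Proof.
elim: j n v => [|x j IH] n v; first by rewrite /= signed0.
case: n => [|n] /=.
  case: eqP => [->|_]; last by rewrite signed0.
  by rewrite !signedA; congr (signed _ _); bool_identity.
transitivity (sl n a c (fun i => signed (e && psum i) (signed (e && p x) (v (x :: i)))) j).
  by apply: sl_ext => i _; rewrite signedA; congr (signed _ _); bool_identity.
rewrite IH sl_signed !signedA; congr (signed _ _); bool_identity.
Qed.

Lemma sl_merge M n a c c' e (v : seq V -> M) j :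
  sl n a c (sl n c' e v) j = if c == c' then sl n a e v j else 0.
Proof.
elim: j n v => [|x j IH] n v; first by rewrite /= if_same.
case: n => [|n] /=; last exact: IH.
case: eqP => _; last by rewrite if_same.
case: eqP => [->|_]; last by rewrite signed0.
by rewrite signedA; congr (signed _ _); bool_identity.
Qed.

(** Only the operator further to the left sees the letter changed by the other one; its suffix
    parity moves by the parity of the other matrix, which gives the supercommutation sign. *)
Lemma sl_comm M n m a c a' c' (v : seq V -> M) j : n != m ->
  sl n a c (sl m a' c' v) j
  = signed ((p a (+) p c) && (p a' (+) p c')) (sl m a' c' (sl n a c v) j).
Proof.
elim: j n m v => [|x j IH] n m v; first by rewrite /= signed0.
case: n m => [|n] [|m] //= nm; last exact: IH.
- case: ifP => xa; last by rewrite sl0 signed0.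
  rewrite sl_psum signedA; congr (signed _ _); bool_identity.
- case: ifP => xa; last by rewrite sl0 signed0.
  by rewrite sl_psum !signedA; congr (signed _ _); bool_identity.
Qed.

(* The signed transposition of the letters at positions [n] and [n.+1]; [sw]
   is its effect on positions. *)
Fixpoint tw M n (v : seq V -> M) j {struct n} : M :=
  match n, j with
  | 0, x :: y :: j' => signed (p x && p y) (v (y :: x :: j'))
  | n'.+1, x :: j' => tw n' (fun i => v (x :: i)) j'
  | _, _ => v j
  end.

Fixpoint sw n t : nat :=
  match n, t with
  | 0, 0 => 1
  | 0, 1 => 0
  | n'.+1, t'.+1 => (sw n' t').+1
  | _, _ => t
  end.

Lemma tw_ext M n (v v' : seq V -> M) j :
  (forall i, size i = size j -> v i = v' i) -> tw n v j = tw n v' j.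
Proof.
elim: n j v v' => [|n IH] [|x [|y j]] v v' e //=; rewrite ?e //.
  by apply: IH => i si; rewrite e //= si.
by apply: IH => i si; rewrite e //= si.
Qed.

Lemma tw_morph M N (f : M -> N) n (v : seq V -> M) j :
  {morph f : x / - x} -> f (tw n v j) = tw n (fun i => f (v i)) j.
Proof.
move=> fN; elim: n j v => [|n IH] [|x j] v //=.
by case: j => [|y j] //; case: (_ && _); rewrite //= fN.
Qed.

Lemma twD M n (v v' : seq V -> M) j :
  tw n (fun i => v i + v' i) j = tw n v j + tw n v' j.
Proof.
elim: n j v v' => [|n IH] [|x j] v v' //=.
by case: j => [|y j] //; rewrite signedD.
Qed.

Lemma tw0 M n j : tw n (fun _ => 0 : M) j = 0.
Proof. by elim: n j => [|n IH] [|x [|y j]] //=; rewrite ?IH ?signed0. Qed.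

Lemma tw_sum M n (I : Type) (r : seq I) (P : pred I) (v : I -> seq V -> M) j :
  tw n (fun i => \sum_(k <- r | P k) v k i) j = \sum_(k <- r | P k) tw n (v k) j.
Proof.
elim: r => [|k r IH].
  rewrite big_nil -[RHS](tw0 M n j); apply: tw_ext => i _; by rewrite big_nil.
rewrite big_cons -IH; case Pk: (P k).
  by rewrite -twD; apply: tw_ext => i _; rewrite big_cons Pk.
by apply: tw_ext => i _; rewrite big_cons Pk.
Qed.

Lemma tw_signed M n b (v : seq V -> M) j :
  tw n (fun i => signed b (v i)) j = signed b (tw n v j).
Proof. by symmetry; apply: (tw_morph (f := signed b)) => x; case: (b). Qed.

Lemma tw_psum M n e (v : seq V -> M) j :
  tw n (fun i => signed (e && psum i) (v i)) j = signed (e && psum j) (tw n v j).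
Proof.
elim: n j v => [|n IH] [|x j] v //=.
  case: j => [|y j] //=; rewrite !signedA; congr (signed _ _); bool_identity.
transitivity (tw n (fun i => signed (e && psum i) (signed (e && p x) (v (x :: i)))) j).
  by apply: tw_ext => i _; rewrite signedA; congr (signed _ _); bool_identity.
rewrite IH tw_signed !signedA; congr (signed _ _); bool_identity.
Qed.

Lemma twK M n (v : seq V -> M) j : tw n (tw n v) j = v j.
Proof.
elim: n j v => [|n IH] [|x j] v //=; last exact: (IH j (fun i => v (x :: i))).
by case: j => [|y j] //=; rewrite signedA andbC addbb.
Qed.

(** When the affected letter crosses a neighbour, that neighbour enters or leaves the suffix read by
    [sl]; the Koszul sign of the swap compensates exactly. The size bound matters because outside
    the word [tw] is the identity while [sw] still moves positions. *)
Lemma tw_sl M n t a c (v : seq V -> M) j : (n.+1 < size j)%N ->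
  tw n (sl t a c v) j = sl (sw n t) a c (tw n v) j.
Proof.
elim: n t j v => [|n IH] t [|x j] v //=.
  case: j => [|y j] //= _; case: t => [|[|t]] /=.
  - case: eqP => [->|_]; last by rewrite signed0.
    by rewrite !signedA; congr (signed _ _); bool_identity.
  - case: eqP => [->|_]; last by rewrite signed0.
    by rewrite !signedA; congr (signed _ _); bool_identity.
  - by rewrite sl_signed.
rewrite ltnS => nj; case: t => [|t] /=; last exact: (IH t j (fun i => v (x :: i))).
by case: ifP => _; rewrite ?tw0 ?tw_psum.
Qed.

(** The transpose of E_ac at a position is E_ca there, with the same sign since the letters on the
    right are untouched. *)
Lemma sl_adj (R : pzRingType) (M : lmodType R) d n a c (u : seq V -> R) (k : seq V -> M) :
  \sum_(b : d.-tuple V) u b *: sl n c a k b = \sum_(b : d.-tuple V) sl n a c u b *: k b.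
Proof.
elim: d n u k => [|d IH] n u k.
  rewrite (sum_tuple_nil (fun b => u b *: sl n c a k b)).
  by rewrite (sum_tuple_nil (fun b => sl n a c u b *: k b)) /= scaler0 scale0r.
rewrite (sum_tuple_cons _ (fun b => u b *: sl n c a k b)).
rewrite (sum_tuple_cons _ (fun b => sl n a c u b *: k b)).
case: n => [|n] /=; last first.
  by apply: eq_bigr => x _; rewrite (IH n (fun i => u (x :: i)) (fun i => k (x :: i))).
rewrite (bigD1 c) //= [X in _ + X]big1 => [|x /negbTE ->]; last first.
  by apply: big1 => w _; rewrite scaler0.
rewrite (bigD1 a) //= [X in _ = _ + X]big1 => [|x /negbTE ->]; last first.
  by apply: big1 => w _; rewrite scale0r.
by rewrite !eqxx !addr0; apply: eq_bigr => w _; rewrite signedZr signedZl addbC.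
Qed.

Lemma tw_adj (R : pzRingType) (M : lmodType R) d n (u : seq V -> R) (k : seq V -> M) :
  \sum_(b : d.-tuple V) u b *: tw n k b = \sum_(b : d.-tuple V) tw n u b *: k b.
Proof.
elim: n d u k => [|n IH] [|d] u k.
- rewrite (sum_tuple_nil (fun b => u b *: tw 0 k b)).
  by rewrite (sum_tuple_nil (fun b => tw 0 u b *: k b)).
- rewrite (sum_tuple_cons _ (fun b => u b *: tw 0 k b)).
  rewrite (sum_tuple_cons _ (fun b => tw 0 u b *: k b)).
  case: d => [|d].
    apply: eq_bigr => x _; rewrite (sum_tuple_nil (fun b => u (x :: b) *: tw 0 k (x :: b))).
    by rewrite (sum_tuple_nil (fun b => tw 0 u (x :: b) *: k (x :: b))).
  transitivity (\sum_x \sum_y \sum_(b : d.-tuple V) u (x :: y :: b) *: tw 0 k (x :: y :: b)).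
    by apply: eq_bigr => x _; rewrite (sum_tuple_cons _ (fun b => u (x :: b) *: tw 0 k (x :: b))).
  rewrite exchange_big; apply: eq_bigr => x _.
  rewrite (sum_tuple_cons _ (fun b => tw 0 u (x :: b) *: k (x :: b))); apply: eq_bigr => y _.
  by apply: eq_bigr => b _ /=; rewrite signedZr signedZl andbC.
- rewrite (sum_tuple_nil (fun b => u b *: tw n.+1 k b)).
  by rewrite (sum_tuple_nil (fun b => tw n.+1 u b *: k b)).
rewrite (sum_tuple_cons _ (fun b => u b *: tw n.+1 k b)).
rewrite (sum_tuple_cons _ (fun b => tw n.+1 u b *: k b)).
by apply: eq_bigr => x _ /=; rewrite (IH d (fun i => u (x :: i)) (fun i => k (x :: i))).
Qed.

Fixpoint str M (w : seq (V * V)) (th : seq nat) (v : seq V -> M) : seq V -> M :=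
  match w, th with
  | e :: w', t :: th' => sl t e.1 e.2 (str w' th' v)
  | _, _ => v
  end.

Lemma str_ext M w th (v v' : seq V -> M) j :
  (forall i, size i = size j -> v i = v' i) -> str w th v j = str w th v' j.
Proof.
elim: w th j => [|e w IH] [|t th] j //= h; rewrite ?h //.
apply: sl_ext => i si; apply: IH => k sk; apply: h; by rewrite sk.
Qed.

Lemma str_shift M w th (v : seq V -> M) x j :
  str w (map succn th) v (x :: j) = str w th (fun i => v (x :: i)) j.
Proof.
elim: w th j => [|e w IH] [|t th] j //=.
by apply: sl_ext => i _; apply: IH.
Qed.

(* The sign relating the product of the [E_ac] at successive positions to the
   matrix unit of the pair of words [(a, c)]. *)
Fixpoint sgw (a c : seq V) : bool :=
  match a, c with
  | x :: a', y :: c' => ((p x (+) p y) && psum a') (+) sgw a' c'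
  | _, _ => false
  end.

Lemma str_iota M (a c j : seq V) (v : seq V -> M) :
  size a = size j -> size c = size j ->
  str (zip a c) (iota 0 (size j)) v j = if j == a then signed (sgw a c) (v c) else 0.
Proof.
elim: j a c v => [|x j IH] [|y a] [|z c] v //= [sa] [sc].
rewrite -[1%N]addn0 iotaDl (eq_map (g := succn)) //.
rewrite eqseq_cons; case: eqP => //= _.
rewrite str_shift IH //; case: eqP => [<-|_]; last by rewrite signed0.
by rewrite signedA.
Qed.

(** A signed permutation is encoded by a word of adjacent transpositions, so its Koszul sign is
    built up one swap at a time; [swl] is the underlying permutation of positions. *)
Definition rho M (l : seq nat) (v : seq V -> M) := foldr (@tw M) v l.
Definition swl (l : seq nat) t := foldr sw t l.

Lemma rho_ext M l (v v' : seq V -> M) j :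
  (forall i, size i = size j -> v i = v' i) -> rho l v j = rho l v' j.
Proof.
elim: l j => [|n l IH] j h /=; first exact: h.
by apply: tw_ext => i si; apply: IH => k sk; apply: h; rewrite sk.
Qed.

Lemma rho_morph M N (f : M -> N) l (v : seq V -> M) j :
  {morph f : x / - x} -> f (rho l v j) = rho l (fun i => f (v i)) j.
Proof.
move=> fN; elim: l j => [|n l IH] j //=; rewrite (tw_morph _ _ _ fN).
by apply: tw_ext => i _; apply: IH.
Qed.

Lemma rho_sum M l (I : Type) (r : seq I) (P : pred I) (v : I -> seq V -> M) j :
  rho l (fun i => \sum_(k <- r | P k) v k i) j = \sum_(k <- r | P k) rho l (v k) j.
Proof.
elim: l j => [|n l IH] j //=; rewrite -tw_sum.
by apply: tw_ext => i _; apply: IH.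
Qed.

Lemma rho_str M l w th (v : seq V -> M) j : all (fun n => n.+1 < size j)%N l ->
  rho l (str w th v) j = str w (map (swl l) th) (rho l v) j.
Proof.
elim: l j => [|n l IH] j /=; first by rewrite map_id.
case/andP=> nj lj.
rewrite (tw_ext n (v' := str w (map (swl l) th) (rho l v))); last first.
  by move=> i si; apply: IH; rewrite si.
rewrite (map_comp (sw n) (swl l)) {IH}; elim: w (map (swl l) th) j nj {lj} => [|e w IHw] [|t th'] j nj //=.
by rewrite tw_sl //; apply: sl_ext => i si; rewrite IHw // si.
Qed.

Lemma rho_revK M l (v : seq V -> M) j : rho l (rho (rev l) v) j = v j.
Proof.
elim: l v j => [|n l IH] v j //=.
rewrite rev_cons /rho foldr_rcons.
rewrite (tw_ext n (v' := tw n v)) ?twK // => i _; exact: IH.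
Qed.

Lemma rho_adj (R : pzRingType) (M : lmodType R) d l (u : seq V -> R) (k : seq V -> M) :
  \sum_(b : d.-tuple V) u b *: rho l k b = \sum_(b : d.-tuple V) rho (rev l) u b *: k b.
Proof.
elim: l u => [|n l IH] u //=.
by rewrite tw_adj IH rev_cons /rho foldr_rcons.
Qed.

End Words.

(** * Permutations of positions as words of adjacent transpositions *)

Lemma swK n : involutive (sw n).
Proof. by elim: n => [|n IH] [|[|t]] //=; congr _.+1; exact: (IH). Qed.

Lemma sw_lt d n t : (n.+1 < d -> t < d -> sw n t < d)%N.
Proof.
elim: n t d => [|n IH] [|[|t]] [|d] //=; rewrite !ltnS.
  by move=> h _; apply: IH => //; apply: leq_ltn_trans h.
exact: IH.
Qed.

Lemma swl_cat l l' t : swl (l ++ l') t = swl l (swl l' t).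
Proof. exact: foldr_cat. Qed.

Lemma swl_revK l : cancel (swl l) (swl (rev l)).
Proof.
elim: l => [|n l IH] t //=.
by rewrite rev_cons -cats1 swl_cat /= swK IH.
Qed.

Lemma swl_inj l : injective (swl l).
Proof. exact: can_inj (@swl_revK l). Qed.

Lemma swl_lt d l t : all (fun n => n.+1 < d)%N l -> (t < d)%N -> (swl l t < d)%N.
Proof. by move=> + td; elim: l => [|n l IH] //= /andP[nd /IH]; apply: sw_lt. Qed.

Lemma swl_succ l t : swl (map succn l) t.+1 = (swl l t).+1.
Proof. by elim: l => [|n l /= ->]. Qed.

Lemma swl_succ0 l : swl (map succn l) 0 = 0%N.
Proof. by elim: l => [|n l /= ->]. Qed.

Lemma sw_self n : sw n n.+1 = n.
Proof. by elim: n => [|n /= ->]. Qed.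

Lemma swl_to0 x : exists2 l, all (fun n => n < x)%N l & swl l x = 0%N.
Proof.
elim: x => [|x [l lx l0]]; first by exists [::].
exists (rcons l x); last by rewrite -cats1 swl_cat /= sw_self.
rewrite all_rcons ltnSn /=; apply: sub_all lx => n; exact: leqW.
Qed.

(** A sorting argument: swaps [l0] bring the first entry to position 0, the remaining entries become
    positive, and after a shift by one they are sorted by induction. *)
Lemma uniq_adjacent_swaps d th : size th = d -> uniq th -> all (fun t => t < d)%N th ->
  exists2 l, all (fun n => n.+1 < d)%N l & th = map (swl l) (iota 0 d).
Proof.
elim: d th => [|d IH] [|x th] //=; first by exists [::].
move=> [sth] /andP[xth uth] /andP[xd thd].
have [l0 l0x l0E] := swl_to0 x.
have l0d : all (fun n => n.+1 < d.+1)%N l0.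
  by apply: sub_all l0x => n nx; apply: leq_trans nx _; rewrite -ltnS.
pose th' := map (predn \o swl l0) th.
have th'E : map (swl l0) th = map succn th'.
  rewrite -map_comp; apply/eq_in_map => t tth /=; rewrite prednK // lt0n.
  by apply: contra xth => /eqP; rewrite -l0E => /swl_inj <-.
have uth' : uniq th'.
  by have := uth; rewrite -(map_inj_uniq (@swl_inj l0)) th'E (map_inj_uniq succn_inj).
have thd' : all (fun t => t < d)%N th'.
  have : all (fun t => t < d.+1)%N (map succn th').
    rewrite -th'E all_map; apply/allP => t tth /=; apply: swl_lt => //.
    exact: (allP thd).
  by rewrite all_map.
have [|l1 l1d th'l1] := IH th' _ uth' thd'; first by rewrite size_map.
(* The shifted swaps fix 0 and arrange the tail; [rev l0] then undoes [l0] and returns 0 to [x]. *)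
exists (rev l0 ++ map succn l1).
  rewrite all_cat all_rev l0d /= all_map; exact: l1d.
rewrite swl_cat swl_succ0 -{1}l0E swl_revK; congr (_ :: _).
rewrite -[1%N]addn0 iotaDl -map_comp.
apply: (inj_map (@swl_inj l0)); rewrite th'E th'l1 -!map_comp.
apply: eq_map => t /=; rewrite swl_cat add1n swl_succ.
by rewrite -{1}(revK l0) swl_revK.
Qed.

(** * Kernels commuting with symmetrized products of elementary matrices *)

Section CommutingKernel.
Variables (F : fieldType) (M : lmodType F) (V : finType) (p : V -> bool) (d : nat).
Variable K : seq V -> seq V -> M.

Local Notation word := (d.-tuple V).
Local Notation sl := (sl p).
Local Notation str := (str p).

Definition phi (v : seq V -> F) j : M := \sum_(b : word) v b *: K j b.

Lemma phi_ext v v' j : (forall i, size i = d -> v i = v' i) -> phi v j = phi v' j.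
Proof. by move=> e; apply: eq_bigr => b _; rewrite e ?size_tuple. Qed.

Lemma phi_sum (I : Type) (r : seq I) (P : pred I) (v : I -> seq V -> F) j :
  phi (fun i => \sum_(k <- r | P k) v k i) j = \sum_(k <- r | P k) phi (v k) j.
Proof. by rewrite [RHS]exchange_big; apply: eq_bigr => b _; rewrite scaler_suml. Qed.

Lemma phiB v v' j : phi (fun i => v i - v' i) j = phi v j - phi v' j.
Proof. by rewrite -sumrB; apply: eq_bigr => b _; rewrite scalerBl. Qed.

Lemma phi_signed b v j : phi (fun i => signed b (v i)) j = signed b (phi v j).
Proof. by rewrite signed_sum; apply: eq_bigr => i _; rewrite signedZl. Qed.

Hypothesis commK : forall a c j b, size j = d -> size b = d ->
  \sum_(t < d) sl t a c (K^~ b) j = \sum_(t < d) sl t c a (K j) b.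

(** Transposing with [sl_adj] turns [commK], a condition on the entries of [K], into the statement
    that the operator [phi] with kernel [K] commutes with E_ac on the d-th tensor power. *)
Lemma phi_total a c v j : size j = d ->
  phi (fun i => \sum_(t < d) sl t a c v i) j = \sum_(t < d) sl t a c (phi v) j.
Proof.
move=> sj; rewrite phi_sum.
transitivity (\sum_(t < d) \sum_(b : word) v b *: sl t c a (K j) b).
  by apply: eq_bigr => t _; rewrite sl_adj.
rewrite exchange_big /=.
transitivity (\sum_(b : word) v b *: \sum_(t < d) sl t a c (K^~ b) j).
  by apply: eq_bigr => b _; rewrite commK ?size_tuple // scaler_sumr.
rewrite (eq_bigr (fun b : word => \sum_(t < d) v b *: sl t a c (K^~ b) j)); last first.
  by move=> b _; rewrite scaler_sumr.
rewrite exchange_big; apply: eq_bigr => t _ /=.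
rewrite sl_sum; apply: eq_bigr => b _; rewrite (sl_morph _ (f := *:%R (v b))) //.
  exact: scaler0.
by move=> x; rewrite scalerN.
Qed.

(* When [E] hits a position already occupied by some factor of [w], the two
   elementary matrices multiply there; the sign does not depend on positions. *)
Lemma str_merge a c w : exists2 r : seq (bool * seq (V * V)),
  (forall x, x \in r -> size x.2 = size w) &
  forall (N : zmodType) (v : seq V -> N) th j, uniq th -> size th = size w ->
    \sum_(t <- th) sl t a c (str w th v) j
    = \sum_(x <- r) signed x.1 (str x.2 th v j).
Proof.
elim: w => [|[a1 c1] w [r rs rE]].
  by exists [::] => // N v [|t th] j // _ _; rewrite !big_nil.
pose e := (p a (+) p c) && (p a1 (+) p c1).
pose r0 := if c == a1 then [:: (false, (a, c1) :: w)] else [::].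
exists (r0 ++ [seq (e (+) x.1, (a1, c1) :: x.2) | x <- r]).
  move=> x; rewrite mem_cat => /orP[|/mapP[y yr ->]]; last by rewrite /= rs.
  by rewrite /r0; case: eqP => // _; rewrite inE => /eqP ->.
move=> N v [|u th] j //= /andP[uth uniqth] [sth].
rewrite big_cons big_cat big_map /=; congr (_ + _).
  rewrite sl_merge /r0; case: eqP => [_|_]; first by rewrite big_seq1.
  by rewrite big_nil.
transitivity (signed e (sl u a1 c1 (fun i => \sum_(t <- th) sl t a c (str w th v) i) j)).
  rewrite sl_sum signed_sum; apply: eq_big_seq => t tth.
  by rewrite sl_comm //; apply: contraNneq uth => <-.
rewrite (sl_ext _ _ _ _ (v' := fun i => \sum_(x <- r) signed x.1 (str x.2 th v i))); last first.
  by move=> i _; apply: rE.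
rewrite sl_sum signed_sum; apply: eq_bigr => x _.
by rewrite sl_signed signedA.
Qed.

(** Symmetrized product: the [k] factors of [w] are distributed over distinct tensor positions in
    all ways. For [k = d] this is a sum over all permutations. *)
Definition symstr (N : zmodType) k w (v : seq V -> N) j : N :=
  \sum_(th : k.-tuple 'I_d | uniq th) str w (map val th) v j.

(** The total action of E_ac puts the new factor either on a free position, which gives the longer
    symmetrized product, or on an occupied one, where it merges into products of the same length
    [k]. The list [r] is chosen before [N] and [v], so one recursion serves on both sides of
    [phi]. *)
Lemma symstr_cons a c k w : size w = k -> exists2 r : seq (bool * seq (V * V)),
  (forall x, x \in r -> size x.2 = k) &
  forall (N : zmodType) (v : seq V -> N) j,
    symstr k.+1 ((a, c) :: w) v j
    = \sum_(t < d) sl t a c (symstr k w v) j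
      - \sum_(x <- r) signed x.1 (symstr k x.2 v j).
Proof.
move=> sw; have [r rs rE] := str_merge a c w; exists r.
  by move=> x /rs ->.
move=> N v j; apply/eqP; rewrite -subr_eq opprK addrC eq_sym; apply/eqP.
have -> : \sum_(x <- r) signed x.1 (symstr k x.2 v j)
  = \sum_(th : k.-tuple 'I_d | uniq th) \sum_(t < d | t \in th) sl t a c (str w (map val th) v) j.
  rewrite (eq_bigr (fun x => \sum_(th : k.-tuple 'I_d | uniq th)
     signed x.1 (str x.2 (map val th) v j))); last by move=> x _; rewrite signed_sum.
  rewrite exchange_big /=; apply: eq_bigr => th uth.
  rewrite -rE ?(map_inj_uniq val_inj) ?size_map ?size_tuple //.
  by rewrite big_map big_uniq.
have -> : symstr k.+1 ((a, c) :: w) v j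
  = \sum_(t < d) \sum_(th : k.-tuple 'I_d)
      if (t \notin th) && uniq th then sl t a c (str w (map val th) v) j else 0.
  rewrite /symstr big_mkcond.
  exact: (sum_tuple_cons _ (fun th : seq 'I_d =>
    if uniq th then str ((a, c) :: w) (map val th) v j else 0)).
have -> : \sum_(t < d) sl t a c (symstr k w v) j
  = \sum_(th : k.-tuple 'I_d | uniq th) \sum_(t < d) sl t a c (str w (map val th) v) j.
  by rewrite exchange_big; apply: eq_bigr => t _; rewrite /symstr sl_sum.
rewrite [X in _ + X]exchange_big [X in _ + X](_ : _ = \sum_(th : k.-tuple 'I_d | uniq th)
  \sum_(t < d | t \notin th) sl t a c (str w (map val th) v) j).
  rewrite -big_split; apply: eq_bigr => th _ /=.
  by rewrite (bigID (fun t : 'I_d => t \in th)).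
rewrite [RHS]big_mkcond; apply: eq_bigr => th _; case: ifP => uth; last first.
  by apply: big1 => t _; rewrite andbF.
by rewrite [RHS]big_mkcond; apply: eq_bigr => t _; rewrite andbT.
Qed.

(** Symmetrized products are polynomials in total actions, by induction through [symstr_cons], and
    [phi] commutes with total actions. *)
Lemma phi_symstr k w v j : size w = k -> size j = d ->
  phi (symstr k w v) j = symstr k w (phi v) j.
Proof.
elim: k w v j => [|k IH] w v j sw sj.
  have e N u i : symstr (N := N) 0 w u i = u i.
    rewrite /symstr (big_pred1 [tuple]) => [|th]; first by case: (w).
    by rewrite (tuple0 th) /= eqxx.
  by rewrite e; apply: phi_ext => i _; rewrite e.
case: w sw => [|[a c] w] //= [sw].
have [r rs rE] := symstr_cons a c sw.
rewrite rE (phi_ext (v' := fun i => \sum_(t < d) sl t a c (symstr k w v) i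
  - \sum_(x <- r) signed x.1 (symstr k x.2 v i))); last by move=> i _; rewrite rE.
rewrite phiB phi_total // phi_sum; congr (_ - _).
  by apply: eq_bigr => t _; apply: sl_ext => i; rewrite sj => si; apply: IH.
rewrite big_seq [RHS]big_seq; apply: eq_bigr => x xr.
by rewrite phi_signed IH // rs.
Qed.

End CommutingKernel.

(** * Kernels commuting with gl(V) *)

Lemma intr_neq0 (F : fieldType) (z : int) : [pchar F] =i pred0 -> z != 0 -> z%:~R != 0 :> F.
Proof.
move=> /pcharf0P F0; case: z => n nz; first by rewrite -[_%:~R]/(n%:R) F0.
by rewrite NegzE mulrNz oppr_eq0 -[_%:~R]/(n.+1%:R) F0.
Qed.

(* [A^T A] and [A] have the same row space over an ordered field. *)
Lemma normal_equations (R : realFieldType) m n (A : 'M[R]_(m, n)) (u : 'rV_m) :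
  exists c : 'rV_n, c *m (A^T *m A) = u *m A.
Proof.
suff /submxP[D AE] : (A <= A^T *m A)%MS by exists (u *m D); rewrite -mulmxA -AE.
rewrite submxE; set Z := cokermx _.
have : (A *m Z)^T *m (A *m Z) = 0.
  by rewrite trmx_mul -mulmxA (mulmxA A^T) mulmx_coker mulmx0.
move: (A *m Z) => B /matrixP B0; apply/eqP/matrixP => i j.
(* A diagonal entry of B^T B is a sum of squares, so its vanishing kills a whole column of B. *)
have := B0 j j; rewrite !mxE => /eqP; rewrite psumr_eq0 => [/allP/(_ i)|k _]; last first.
  by rewrite mxE -expr2 sqr_ge0.
by rewrite mem_index_enum mxE /= mulf_eq0 orbb => /(_ isT)/eqP.
Qed.

(** The normal equations for row [i0] are solved over the rationals and denominators are cleared, so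
    that the solution can be mapped into any field of characteristic zero. *)
Lemma integer_normal_equations (I J : finType) (A : I -> J -> int) (i0 : I) :
  exists2 D : int, D != 0 & exists c : J -> int,
    forall k, \sum_j c j * \sum_i A i j * A i k = D * A i0 k.
Proof.
pose B : 'M[rat]_(#|I|, #|J|) := \matrix_(i, j) (A (enum_val i) (enum_val j))%:~R.
have [c cE] := normal_equations B (delta_mx 0 (enum_rank i0)).
pose q j : rat := c 0 (enum_rank j).
pose D : int := \prod_j denq (q j).
exists D; first by apply/prodf_neq0 => j _; apply: denq_neq0.
exists (fun j => numq (q j) * \prod_(i | i != j) denq (q i)) => k.
apply/(@intr_inj rat); rewrite intrM /= rmorph_sum /=.
have zE j : (numq (q j) * \prod_(i | i != j) denq (q i))%:~R = D%:~R * q j :> rat.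
  rewrite /D [X in _ = X%:~R * _](bigD1 j) //= !intrM -[X in _ = _ * X]divq_num_den.
  by rewrite [RHS]mulrC mulrA divfK ?intr_eq0 ?denq_neq0.
transitivity (D%:~R * (c *m (B^T *m B)) 0 (enum_rank k)).
  rewrite mxE mulr_sumr (reindex (@enum_rank J)) /=; last first.
    by exists enum_val => j _; rewrite ?enum_rankK ?enum_valK.
  apply: eq_bigr => j _; rewrite intrM /= zE -mulrA; congr (_ * (_ * _)).
  rewrite mxE rmorph_sum (reindex (@enum_rank I)) /=; last first.
    by exists enum_val => i _; rewrite ?enum_rankK ?enum_valK.
  by apply: eq_bigr => i _; rewrite !mxE !enum_rankK intrM.
by rewrite cE -rowE !mxE !enum_rankK.
Qed.

Section KernelSpan.
Variables (V : finType) (p : V -> bool).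

Local Notation sl := (sl p).
Local Notation str := (str p).
Local Notation rho := (rho p).

(** Matrix entries of a signed permutation, taken in the integers so that the linear algebra is done
    once over an ordered field. *)
Definition rcoef (l : seq nat) (x y : seq V) : int := rho l (fun i => (i == y)%:R) x.

Lemma sum_delta_tuple (R : pzRingType) (M : lmodType R) d (v : seq V -> M) x :
  size x = d -> \sum_(k : d.-tuple V) (x == k)%:R *: v k = v x.
Proof.
move/eqP=> sx; rewrite (bigD1 (Tuple sx)) //= eqxx scale1r big1 ?addr0 // => k.
by rewrite -val_eqE /= eq_sym => /negbTE ->; rewrite scale0r.
Qed.

Lemma rho_coef (R : pzRingType) (M : lmodType R) d l (v : seq V -> M) x : size x = d ->
  rho l v x = \sum_(k : d.-tuple V) (rcoef l x k)%:~R *: v k.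
Proof.
move=> sx.
rewrite (rho_ext _ _ (v' := fun i => \sum_(k : d.-tuple V) ((i == k)%:R : int)%:~R *: v k)).
  rewrite rho_sum; apply: eq_bigr => k _.
  rewrite -(rho_morph _ (f := fun z : int => z%:~R *: v k)) // => z.
  by rewrite mulrNz scaleNr.
move=> i; rewrite sx => si; rewrite -[LHS](sum_delta_tuple v si).
by apply: eq_bigr => k _; case: (i == k).
Qed.

(** Signed permutation matrices are orthogonal: reversing the word inverts the operator and
    transposes its matrix. *)
Lemma rcoef_rev d l (x y : seq V) : size x = d -> size y = d ->
  rcoef (rev l) x y = rcoef l y x.
Proof.
move=> sx sy.
rewrite -[LHS](sum_delta_tuple (M := int^o) (rcoef (rev l) ^~ y) sx).
rewrite -[RHS](sum_delta_tuple (M := int^o) (rcoef l ^~ x) sy).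
transitivity (\sum_(b : d.-tuple V) rcoef (rev l) b y *: ((b == x :> seq V)%:R : int^o)).
  by apply: eq_bigr => b _; rewrite eq_sym [LHS]mulrC.
rewrite -(rho_adj p (M := int^o) d l (fun i => (i == y)%:R) (fun i => (i == x)%:R)).
by apply: eq_bigr => b _; rewrite eq_sym.
Qed.

Lemma str_conj (N : zmodType) d l w (v : seq V -> N) j :
  size j = d -> all (fun n => n.+1 < d)%N l ->
  str w (map (swl l) (iota 0 d)) v j = rho l (str w (iota 0 d) (rho (rev l) v)) j.
Proof.
move=> sj ld; rewrite rho_str ?sj //; apply: str_ext => i _.
by rewrite rho_revK.
Qed.

(** Conjugating a matrix unit by a permutation gives a matrix of rank one: column [a] of the
    permutation times row [c] of its inverse. *)
Lemma str_conj_coef (R : pzRingType) (M : lmodType R) d l (a c j : d.-tuple V) (v : seq V -> M) :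
  all (fun n => n.+1 < d)%N l ->
  str (zip a c) (map (swl l) (iota 0 d)) v j
  = signed (sgw p a c) ((rcoef l j a)%:~R *: rho (rev l) v c).
Proof.
move=> ld; rewrite str_conj ?size_tuple // (@rho_coef _ _ d) ?size_tuple //.
rewrite (bigD1 a) //= big1 => [|k ka].
  have := str_iota p (rho (rev l) v) (erefl (size a)).
  rewrite size_tuple => ->; last by rewrite size_tuple.
  by rewrite eqxx addr0 signedZr.
have := @str_iota _ p _ a c k (rho (rev l) v); rewrite !size_tuple => -> //.
by rewrite val_eqE (negbTE ka) scaler0.
Qed.

Variables (F : fieldType) (M : lmodType F) (d : nat) (K : seq V -> seq V -> M).
Hypothesis charF0 : [pchar F] =i pred0.
Hypothesis commK : forall a c j b, size j = d -> size b = d ->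
  \sum_(t < d) sl t a c (K^~ b) j = \sum_(t < d) sl t c a (K j) b.

(** The second clause keeps each [H i] in the span of the entries of [K], so that any linear map
    killing all entries of [K] also kills [H i]. *)
Lemma commuting_kernel_span :
  exists (I : finType) (l : I -> seq nat) (H : I -> M),
  [/\ forall i, all (fun n => n.+1 < d)%N (l i),
      forall i, exists k : d.-tuple V -> d.-tuple V -> F, H i = \sum_x \sum_y k x y *: K x y
    & forall b y : d.-tuple V, K b y = \sum_i (rcoef (l i) y b)%:~R *: H i].
Proof.
(* The identity tuple is given the empty word, so that its matrix is literally the Kronecker
   delta. *)
have /fin_all_exists[l lP] : forall th : d.-tuple 'I_d, exists l : seq nat,
  [/\ all (fun n => n.+1 < d)%N l,
      uniq th -> map val th = map (swl l) (iota 0 d) & map val th = iota 0 d -> l = [::]].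
  move=> th; have [e|ne] := eqVneq (map val th) (iota 0 d).
    by exists [::]; split=> // _; rewrite e; apply/esym/map_id.
  have [uth|nuth] := boolP (uniq th); last by exists [::]; split.
  have [|||l ld lE] := @uniq_adjacent_swaps d (map val th).
  - by rewrite size_map size_tuple.
  - by rewrite (map_inj_uniq val_inj).
  - by apply/allP => _ /mapP[t _ ->]; apply: ltn_ord.
  by exists l; split=> // /eqP; rewrite (negbTE ne).
(* Tuples with repetitions get the zero matrix, so that sums may range over all tuples. *)
pose r (th : d.-tuple 'I_d) (x y : seq V) : int := if uniq th then rcoef (l th) x y else 0.
have symstrE (N : lmodType F) (a c j : d.-tuple V) (v : seq V -> N) :
  symstr p d d (zip a c) v j
  = signed (sgw p a c) (\sum_th (r th j a)%:~R *: rho (rev (l th)) v c).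
  rewrite /symstr big_mkcond signed_sum; apply: eq_bigr => th _.
  have [ld lE _] := lP th; rewrite /r; case: ifP => uth.
    by rewrite lE // str_conj_coef.
  by rewrite scale0r signed0.
(* This is commutation of [phi] with the symmetrized matrix unit of [(a, c)], evaluated at [x] on
   the delta function at [y], with both sides expanded into rank one terms. *)
have key (x y a c : d.-tuple V) :
    \sum_th (r th x a)%:~R *: (\sum_(m : d.-tuple V) (r th m c)%:~R *: K m y)
    = \sum_th (r th y c)%:~R *: (\sum_(m : d.-tuple V) (r th m a)%:~R *: K x m).
  have := phi_symstr (p := p) (K := K) commK (w := zip a c) (fun i => (i == y)%:R) (j := x).
  move=> /(_ d); rewrite size_zip !size_tuple minnn => /(_ erefl erefl) E.
  apply: (@signedI _ (sgw p a c)); transitivity (symstr p d d (zip a c) (phi d K (fun i => (i == y)%:R)) x).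
    rewrite symstrE; congr signed; apply: eq_bigr => th _.
    rewrite /r; case: ifP => uth; last by rewrite !scale0r.
    rewrite (@rho_coef _ _ d) ?size_tuple //; congr (_ *: _); apply: eq_bigr => m _.
    rewrite (@rcoef_rev d) ?size_tuple //; congr (_ *: _).
    rewrite /phi -[LHS](sum_delta_tuple (K m) (size_tuple y)).
    by apply: eq_bigr => b _; rewrite eq_sym.
  rewrite -E /phi.
  transitivity (\sum_(b : d.-tuple V) signed (sgw p a c)
    (\sum_th ((r th b a)%:~R * (r th y c)%:~R) *: K x b)).
    apply: eq_bigr => b _; rewrite (symstrE F^o) signedZl scaler_suml; congr signed.
    apply: eq_bigr => th _; congr (_ *: _).
    rewrite /r; case: ifP => uth; last by rewrite scale0r mul0r.
    congr (_ * _); rewrite (rho_coef (M := F^o) _ _ (size_tuple c)).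
    rewrite -(rcoef_rev _ (size_tuple c) (size_tuple y)).
    rewrite -[RHS](sum_delta_tuple (M := F^o) (fun k => (rcoef (rev (l th)) c k)%:~R) (size_tuple y)).
    by apply: eq_bigr => k _; rewrite eq_sym [LHS]mulrC.
  rewrite -signed_sum exchange_big; congr signed; apply: eq_bigr => th _ /=.
  by rewrite scaler_sumr; apply: eq_bigr => b _; rewrite scalerA mulrC.
have uid : uniq (ord_tuple d) by rewrite /= enum_uniq.
have lid : l (ord_tuple d) = [::].
  by have [_ _ ->] := lP (ord_tuple d); rewrite //= val_enum_ord.
(* Rows are permutations and columns are pairs of words; the chosen row is the identity
   permutation. *)
have [D Dn0 [c cE]] := integer_normal_equations
  (fun th (u : d.-tuple V * d.-tuple V) => r th u.1 u.2) (ord_tuple d).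
have DF : D%:~R != 0 :> F by apply: intr_neq0.
pose H th : M := D%:~R^-1 *: \sum_(u : d.-tuple V * d.-tuple V)
   (c u)%:~R *: (\sum_(m : d.-tuple V) (r th m u.2)%:~R *: K u.1 m).
exists (d.-tuple 'I_d : finType), l, (fun th : d.-tuple 'I_d => if uniq th then H th else 0); split.
- by move=> th; have [] := lP th.
- move=> th; case: ifP => uth; last first.
    by exists (fun _ _ => 0); rewrite big1 // => x _; rewrite big1 // => y _; rewrite scale0r.
  exists (fun x m => D%:~R^-1 * \sum_(a : d.-tuple V) (c (x, a))%:~R * (r th m a)%:~R).
  rewrite /H (eq_bigr (fun u => (c (u.1, u.2))%:~R *:
    (\sum_(m : d.-tuple V) (r th m u.2)%:~R *: K u.1 m))); last by case.
  rewrite -(pair_bigA _ (fun x a : d.-tuple V => (c (x, a))%:~R *: (\sum_(m : d.-tuple V) (r th m a)%:~R *: K x m))) /=.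
  rewrite scaler_sumr; apply: eq_bigr => x _.
  transitivity (D%:~R^-1 *: \sum_(a : d.-tuple V) \sum_(m : d.-tuple V) ((c (x, a))%:~R * (r th m a)%:~R) *: K x m).
    congr (_ *: _); apply: eq_bigr => a _; rewrite scaler_sumr.
    by apply: eq_bigr => m _; rewrite scalerA.
  rewrite exchange_big scaler_sumr; apply: eq_bigr => m _ /=.
  by rewrite -scaler_suml scalerA.
move=> b y; apply: (scalerI DF).
(* Contracting [key] over its indices [x] and [a] with the weights [c] makes the right side a
   combination of permutation matrices with coefficients [H]. *)
have {}key : \sum_(u : d.-tuple V * d.-tuple V) (c u)%:~R *: \sum_th (r th u.1 u.2)%:~R *:
   (\sum_(m : d.-tuple V) (r th m b)%:~R *: K m y)
   = D%:~R *: \sum_th (r th y b)%:~R *: H th.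
  rewrite (eq_bigr _ (fun u _ => congr1 _ (key u.1 y u.2 b))) scaler_sumr.
  transitivity (\sum_(u : d.-tuple V * d.-tuple V) \sum_th (r th y b)%:~R *: ((c u)%:~R *: (\sum_(m : d.-tuple V) (r th m u.2)%:~R *: K u.1 m))).
    by apply: eq_bigr => u _; rewrite scaler_sumr; apply: eq_bigr => th _; rewrite !scalerA mulrC.
  rewrite exchange_big; apply: eq_bigr => th _.
  by rewrite -scaler_sumr /H !scalerA mulrAC mulfV // mul1r.
transitivity (D%:~R *: \sum_th (r th y b)%:~R *: H th); last first.
  congr (_ *: _); apply: eq_bigr => th _; rewrite /r.
  by case: ifP; rewrite // scale0r scaler0.
rewrite -key.
transitivity (\sum_(m : d.-tuple V) (\sum_(u : d.-tuple V * d.-tuple V)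
   c u * \sum_th r th u.1 u.2 * r th m b)%:~R *: K m y).
  (* On the left the normal equations leave [D] times the row of the identity, so only the term
     [m = b] survives. *)
  under [RHS]eq_bigr => m _ do rewrite (cE (m, b)) /=.
  rewrite (bigD1 b) //= big1 => [|m mb].
    by rewrite addr0 /r uid lid /rcoef /= eqxx mulr1.
  have /negbTE mb' : (m : seq V) != b by [].
  by rewrite /r uid lid /rcoef /= mb' mulr0 scale0r.
under eq_bigr do rewrite rmorph_sum /= scaler_suml.
rewrite exchange_big; apply: eq_bigr => u _ /=.
rewrite [RHS](_ : _ = \sum_(m : d.-tuple V) \sum_th (c u)%:~R *: ((r th u.1 u.2)%:~R *: ((r th m b)%:~R *: K m y))).
  apply: eq_bigr => m _; rewrite intrM rmorph_sum /= -scalerA scaler_suml scaler_sumr.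
  by apply: eq_bigr => th _; rewrite intrM /= -scalerA.
rewrite exchange_big scaler_sumr; apply: eq_bigr => th _ /=.
by rewrite !scaler_sumr.
Qed.
End KernelSpan.

(** * Weyl-Clifford modules *)

Section WeylClifford.
Variables (F : fieldType) (A : lmodType F) (G : finType) (par : G -> bool).
Variables X D : G -> {linear A -> A}.
Implicit Types (Q : pred G) (u v : A) (s n : nat).
Hypothesis charF0 : [pchar F] =i pred0.
Hypothesis XX : forall g h v, X g (X h v) = signed (par g && par h) (X h (X g v)).
Hypothesis DD : forall g h v, D g (D h v) = signed (par g && par h) (D h (D g v)).
Hypothesis DX : forall g h v,
  D g (X h v) = (if g == h then v else 0) + signed (par g && par h) (X h (D g v)).

Definition quad (I : finType) (b : I -> bool) (g h : I -> G) (v : A) : A :=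
  \sum_i signed (b i) (X (g i) (D (h i) v)).

Section Quad.
Variables (I : finType) (b : I -> bool) (g h : I -> G) (e : bool).
Hypothesis gh : forall i, par (g i) (+) par (h i) = e.

(** Only contractions of [D k] with the multiplications [X (g i)] survive in the supercommutator,
    which is therefore linear in the derivatives. *)
Lemma D_quad k v : D k (quad b g h v) = signed (e && par k) (quad b g h (D k v))
  + \sum_i signed (b i) (if k == g i then D (h i) v else 0).
Proof.
rewrite /quad linear_sum signed_sum -big_split; apply: eq_bigr => i _ /=.
rewrite linear_signed DX signedD addrC; congr (_ + _).
rewrite DD linear_signed !signedA; congr (signed _ _).
by rewrite -(gh i); bool_identity.
Qed.

Lemma quad_X k v : quad b g h (X k v) = signed (e && par k) (X k (quad b g h v))
  + \sum_i signed (b i) (if h i == k then X (g i) v else 0).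
Proof.
rewrite /quad linear_sum signed_sum -big_split; apply: eq_bigr => i _ /=.
rewrite DX linearD signedD addrC (fun_if (X (g i))) linear0; congr (_ + _).
rewrite linear_signed XX linear_signed !signedA; congr (signed _ _).
by rewrite -(gh i); bool_identity.
Qed.
End Quad.

(** The degree operator counting the generators selected by [Q]. *)
Definition euler (Q : pred G) (v : A) : A := \sum_(g | Q g) X g (D g v).

Lemma euler_is_linear Q : linear (euler Q).
Proof.
move=> c u v; rewrite /euler scaler_sumr -big_split; apply: eq_bigr => g _ /=.
by rewrite !linearP.
Qed.
HB.instance Definition _ Q := GRing.isLinear.Build F A A *:%R (euler Q) (euler_is_linear Q).

Lemma D_euler Q k v : D k (euler Q v) = euler Q (D k v) + (if Q k then D k v else 0).
Proof.
rewrite [RHS]addrC /euler linear_sum.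
rewrite (eq_bigr (fun g => (if k == g then D k v else 0) + X g (D g (D k v)))); last first.
  move=> g _; rewrite DX DD linear_signed signedA andbC addbb; congr (_ + _).
  by case: eqP => // ->.
rewrite big_split; congr (_ + _) => /=.
rewrite -big_mkcondr /= big_mkcond /= (bigD1 k) //= eqxx andbT big1 ?addr0 // => g.
by rewrite eq_sym => /negbTE ->; rewrite andbF.
Qed.

Lemma euler_X Q k v : euler Q (X k v) = X k (euler Q v) + (if Q k then X k v else 0).
Proof.
rewrite [RHS]addrC /euler linear_sum.
rewrite (eq_bigr (fun g => (if k == g then X k v else 0) + X k (X g (D g v)))); last first.
  move=> g _; rewrite DX linearD (fun_if (X g)) linear0 linear_signed XX signedA addbb.
  by rewrite eq_sym; congr (_ + _); case: eqP => // ->.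
rewrite big_split; congr (_ + _) => /=.
rewrite -big_mkcondr /= big_mkcond /= (bigD1 k) //= eqxx andbT big1 ?addr0 // => g.
by rewrite eq_sym => /negbTE ->; rewrite andbF.
Qed.

Lemma euler_quad Q (I : finType) b (g h : I -> G) v : (forall i, Q (g i) = Q (h i)) ->
  euler Q (quad b g h v) = quad b g h (euler Q v).
Proof.
move=> Qgh; rewrite /quad linear_sum; apply: eq_bigr => i _.
rewrite linear_signed /=; congr (signed _ _).
rewrite euler_X D_euler linearD Qgh; congr (_ + _).
by rewrite (fun_if (X (g i))) linear0.
Qed.

Fixpoint Dword (w : seq G) (v : A) : A := if w is g :: w' then Dword w' (D g v) else v.

Hypothesis Dnil : forall v, exists n, forall w, size w = n -> Dword w v = 0.

(* The product of the operators [euler Q - i] over [s <= i < s + n]. *)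
Fixpoint efall Q s n (v : A) : A :=
  if n is n'.+1 then euler Q (efall Q s.+1 n' v) - s%:R *: efall Q s.+1 n' v else v.

Lemma efall_is_linear Q s n : linear (efall Q s n).
Proof.
elim: n s => [|n IH] s c u v //=; rewrite !IH linearP scalerDr scalerBr opprD addrACA.
by rewrite !scalerA mulrC.
Qed.
HB.instance Definition _ Q s n :=
  GRing.isLinear.Build F A A *:%R (efall Q s n) (efall_is_linear Q s n).

Lemma efall_D Q s n k v : Q k -> efall Q s n (D k v) = D k (efall Q s.+1 n v).
Proof.
move=> Qk; elim: n s => [|n IH] s //=; rewrite IH [RHS]linearB [D k (_ *: _)]linearZ /= D_euler Qk.
by rewrite -[RHS]addrA; congr (_ + _); rewrite -natr1 scalerDl scale1r opprD [RHS]addrCA subrr addr0.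
Qed.

Lemma efall_eigen Q s n c v : euler Q v = c *: v ->
  efall Q s n v = (\prod_(i < n) (c - (s + i)%:R)) *: v.
Proof.
move=> Lv; elim: n s => [|n IH] s; first by rewrite big_ord0 scale1r.
rewrite /= IH [euler Q (_ *: _)]linearZ /= Lv big_ord_recl addn0 !scalerA -scalerBl mulrC -mulrBl.
congr (_ * _ *: _); apply: eq_bigr => i _.
by rewrite addSnnS.
Qed.

(** The falling factorial E(E-1)...(E-n+1) of the Euler operator brings [n] derivatives to act on
    [v], by [efall_D]; local nilpotency makes it vanish. Hence only natural eigenvalues can
    occur. *)
Lemma efall_nil Q v : exists n, efall Q 0 n v = 0.
Proof.
have [n nP] := Dnil v; exists n; elim: n v nP => [|n IH] v nP; first exact: (nP [::]).
rewrite /= scale0r subr0 /euler big1 // => g Qg.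
by rewrite -efall_D // IH ?linear0 // => w sw; apply: (nP (g :: w)); rewrite /= sw.
Qed.

Lemma natr_neq0 n : (0 < n)%N -> n%:R != 0 :> F.
Proof. by move/pcharf0P: charF0 => ->; rewrite lt0n. Qed.

(** The derivative would have degree -1, and the falling factorials act at -1 by products of the
    nonzero scalars -(i+1). *)
Lemma euler_eq0 Q g v : Q g -> euler Q v = 0 -> D g v = 0.
Proof.
move=> Qg Lv; have := D_euler Q g v; rewrite Lv linear0 Qg => /esym/eqP.
rewrite addr_eq0 -scaleN1r => /eqP LD.
have [n] := efall_nil Q (D g v); rewrite (efall_eigen _ _ LD) => /eqP.
rewrite scaler_eq0 => /orP[|/eqP//] /prodf_eq0[i _].
by rewrite -opprD add0n nat1r oppr_eq0 (negbTE (natr_neq0 _)).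
Qed.

Lemma efall_comm Q s n k v :
  efall Q s n (euler Q v - k *: v) = euler Q (efall Q s n v) - k *: efall Q s n v.
Proof.
elim: n s => [|n IH] s //=; rewrite IH.
rewrite ![euler Q (_ - _)]linearB /= ![euler Q (_ *: _)]linearZ /= !scalerBr !scalerA.
rewrite !opprB [s%:R * k]mulrC -!addrA; congr (_ + _).
by rewrite addrCA [RHS]addrCA; congr (_ + _); rewrite addrC.
Qed.

Lemma efall_recr Q s n v :
  efall Q s n.+1 v = efall Q s n (euler Q v - (s + n)%:R *: v).
Proof.
elim: n s => [|n IH] s; first by rewrite /= addn0.
by rewrite [LHS]/= -/(efall Q s.+1 n.+1 v) IH addSnnS.
Qed.

(** Homogeneous components are split off one at a time, from the top degree allowed by [efall_nil];
    [P] is stable under the Euler operator, so it passes to every component. *)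
Lemma euler_components Q (P T : A -> Prop) :
  (forall k u v, P u -> P v -> P (k *: u + v)) -> (forall v, P v -> P (euler Q v)) ->
  (forall k u v, T u -> T v -> T (k *: u + v)) ->
  (forall d v, P v -> euler Q v = d%:R *: v -> T v) ->
  forall v, P v -> T v.
Proof.
move=> Plin PL Tlin PT v; have [n] := efall_nil Q v.
have Pfall s m u : P u -> P (efall Q s m u).
  move=> Pu; elim: m s => [|m IH] s //=.
  by rewrite addrC -scaleNr; apply: Plin => //; apply: PL.
elim: n v => [|n IH] v /= v0 Pv.
  by apply: (PT 0%N) => //; rewrite v0 linear0 scaler0.
pose u := efall Q 0 n v.
have Lu : euler Q u = n%:R *: u.
  by apply/eqP; rewrite -subr_eq0 -efall_comm -[n in n%:R]add0n -efall_recr /= v0.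
(* The scalar n! by which E(E-1)...(E-n+1) acts in degree [n]; subtracting [k^-1 *: u] from [v]
   leaves an element killed by this shorter product. *)
pose k : F := \prod_(i < n) (n%:R - (0 + i)%:R).
have kn0 : k != 0.
  apply/prodf_neq0 => i _; rewrite add0n -natrB ?natr_neq0 ?subn_gt0 //.
  exact: ltnW.
have Pu : P u by apply: Pfall.
have -> : v = k^-1 *: u + (- k^-1 *: u + v) by rewrite addrA -scalerDl subrr scale0r add0r.
apply: Tlin; first exact: PT Pu Lu.
apply: IH; last exact: Plin.
rewrite linearP /= -/u (efall_eigen _ _ Lu) -/k scalerA mulNr mulVf // scaleN1r.
by rewrite addNr.
Qed.
End WeylClifford.

Lemma sum_if_eq (M : zmodType) (I : finType) (i0 : I) b (f : I -> M) :
  \sum_i (if (i0 == i) && b then f i else 0) = if b then f i0 else 0.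
Proof.
rewrite (bigD1 i0) //= eqxx big1 ?addr0 // => i /negbTE.
by rewrite eq_sym => ->.
Qed.

(** * Invariants of gl(V) in a Weyl-Clifford module *)

Section Invariants.
Variables (F : fieldType) (A : lmodType F) (RU RV RW : finType).
Variables (pU : RU -> bool) (pV : RV -> bool) (pW : RW -> bool).
Local Notation G := ((RU * RV) + (RV * RW))%type.
Variables X D : G -> {linear A -> A}.
Hypothesis charF0 : [pchar F] =i pred0.

Definition gpar (g : G) : bool :=
  match g with
  | inl (r, i) => pU r (+) pV i
  | inr (i, s) => pV i (+) pW s
  end.

Hypothesis XX : forall g h v, X g (X h v) = signed (gpar g && gpar h) (X h (X g v)).
Hypothesis DD : forall g h v, D g (D h v) = signed (gpar g && gpar h) (D h (D g v)).
Hypothesis DX : forall g h v,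
  D g (X h v) = (if g == h then v else 0) + signed (gpar g && gpar h) (X h (D g v)).
Hypothesis Dnil : forall v, exists n, forall w, size w = n -> Dword D w v = 0.

Local Notation x r i := (X (inl (r, i))).
Local Notation dx r i := (D (inl (r, i))).
Local Notation y i s := (X (inr (i, s))).
Local Notation dy i s := (D (inr (i, s))).

(* [e1 a c] is the action of [E_ac] on the first tensor factor and [e2 c a] is,
   up to a sign, its opposite on the second one. *)
Definition e1 a c : A -> A :=
  quad X D (fun r => (pV a (+) pV c) && pU r) (fun r => inl (r, a)) (fun r => inl (r, c)).
Definition e2 c a : A -> A :=
  quad X D (fun _ : RW => false) (fun s => inr (c, s)) (fun s => inr (a, s)).

(** Invariance under every E_ac, with the contribution of the dual factor moved to the right
    side. *)
Definition inv v := forall a c, e1 a c v = signed ((pV a (+) pV c) && pV a) (e2 c a v).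

Let gp1 a c (r : RU) : gpar (inl (r, a)) (+) gpar (inl (r, c)) = pV a (+) pV c.
Proof. by rewrite /=; bool_identity. Qed.

Let gp2 c a (s : RW) : gpar (inr (c, s)) (+) gpar (inr (a, s)) = pV a (+) pV c.
Proof. by rewrite /=; bool_identity. Qed.

Let inl_eq (u v : RU * RV) : ((inl u : G) == inl v) = (u == v). Proof. by []. Qed.
Let inr_eq (u v : RV * RW) : ((inr u : G) == inr v) = (u == v). Proof. by []. Qed.

Lemma dx_e1 r j a c v :
  dx r j (e1 a c v)
  = signed ((pV a (+) pV c) && (pU r (+) pV j)) (e1 a c (dx r j v))
    + (if j == a then signed ((pV a (+) pV c) && pU r) (dx r c v) else 0).
Proof.
rewrite (D_quad DD DX _ (gp1 a c)); congr (_ + _).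
rewrite -(sum_if_eq r _ (fun r' => signed ((pV a (+) pV c) && pU r') (dx r' c v))).
by apply: eq_bigr => r' _; rewrite inl_eq xpair_eqE signed_if.
Qed.

Lemma dy_e1 i s a c v :
  dy i s (e1 a c v) = signed ((pV a (+) pV c) && (pV i (+) pW s)) (e1 a c (dy i s v)).
Proof.
rewrite (D_quad DD DX _ (gp1 a c)) [X in _ + X]big1 ?addr0 // => r' _.
by rewrite signed0.
Qed.

Lemma dy_e2 i s a c v :
  dy i s (e2 c a v)
  = signed ((pV a (+) pV c) && (pV i (+) pW s)) (e2 c a (dy i s v))
    + (if i == c then dy a s v else 0).
Proof.
rewrite (D_quad DD DX _ (gp2 c a)); congr (_ + _).
rewrite -(sum_if_eq s _ (fun s' => dy a s' v)).
by apply: eq_bigr => s' _; rewrite inr_eq xpair_eqE andbC.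
Qed.

Lemma e1_x r j a c v :
  e1 a c (x r j v)
  = signed ((pV a (+) pV c) && (pU r (+) pV j)) (x r j (e1 a c v))
    + (if j == c then signed ((pV a (+) pV c) && pU r) (x r a v) else 0).
Proof.
rewrite /e1 (quad_X XX DX _ (gp1 a c)); congr (_ + _).
rewrite -(sum_if_eq r _ (fun r' => signed ((pV a (+) pV c) && pU r') (x r' a v))).
by apply: eq_bigr => r' _; rewrite inl_eq eq_sym xpair_eqE signed_if.
Qed.

Lemma e1_y i s a c v :
  e1 a c (y i s v) = signed ((pV a (+) pV c) && (pV i (+) pW s)) (y i s (e1 a c v)).
Proof.
rewrite /e1 (quad_X XX DX _ (gp1 a c)) [X in _ + X]big1 ?addr0 // => r' _.
by rewrite signed0.
Qed.

Lemma e2_x r j a c v :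
  e2 c a (x r j v) = signed ((pV a (+) pV c) && (pU r (+) pV j)) (x r j (e2 c a v)).
Proof. by rewrite /e2 (quad_X XX DX _ (gp2 c a)) [X in _ + X]big1 ?addr0. Qed.

Lemma e2_y i s a c v :
  e2 c a (y i s v)
  = signed ((pV a (+) pV c) && (pV i (+) pW s)) (y i s (e2 c a v))
    + (if i == a then y c s v else 0).
Proof.
rewrite /e2 (quad_X XX DX _ (gp2 c a)); congr (_ + _).
rewrite -(sum_if_eq s _ (fun s' => y c s' v)).
by apply: eq_bigr => s' _; rewrite inr_eq eq_sym xpair_eqE andbC.
Qed.

Lemma e1_is_linear a c : linear (e1 a c).
Proof.
move=> k u v; rewrite /e1 /quad scaler_sumr -big_split; apply: eq_bigr => i _ /=.
by rewrite !linearP signedD signedZr.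
Qed.
HB.instance Definition _ a c := GRing.isLinear.Build F A A *:%R (e1 a c) (e1_is_linear a c).

Lemma e2_is_linear a c : linear (e2 a c).
Proof.
move=> k u v; rewrite /e2 /quad scaler_sumr -big_split; apply: eq_bigr => i _ /=.
by rewrite !linearP.
Qed.
HB.instance Definition _ a c := GRing.isLinear.Build F A A *:%R (e2 a c) (e2_is_linear a c).

Definition pairop r s v := \sum_i x r i (y i s v).

Lemma pairop_is_linear r s : linear (pairop r s).
Proof.
move=> k u v; rewrite /pairop scaler_sumr -big_split; apply: eq_bigr => i _ /=.
by rewrite !linearP.
Qed.
HB.instance Definition _ r s :=
  GRing.isLinear.Build F A A *:%R (pairop r s) (pairop_is_linear r s).

(** Besides the terms where the operators pass through to [v], each side produces a single extra
    term, and both are [x r a (y c s v)] up to the same sign. *)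
Lemma inv_pairop r s v : inv v -> inv (pairop r s v).
Proof.
move=> vinv a c; rewrite /pairop [LHS]linear_sum [in RHS]linear_sum /=.
pose e := pV a (+) pV c.
rewrite (eq_bigr (fun i => signed (e && (pU r (+) pW s)) (x r i (y i s (e1 a c v)))
  + (if c == i then signed (e && pU r) (x r a (y i s v)) else 0))); last first.
  move=> i _; rewrite e1_x e1_y linear_signed signedA eq_sym; congr (_ + _).
  by congr (signed _ _); rewrite /e; bool_identity.
rewrite [in RHS](eq_bigr (fun i => signed (e && (pU r (+) pW s)) (x r i (y i s (e2 c a v)))
  + (if a == i then signed (e && (pU r (+) pV a)) (x r i (y c s v)) else 0))); last first.
  move=> i _; rewrite e2_x e2_y linearD linear_signed signedD signedA; congr (_ + _).
    by congr (signed _ _); rewrite /e; bool_identity.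
  rewrite (fun_if (x r i)) linear0 signed_if [i == a]eq_sym.
  by rewrite /e; case: eqP => // ->.
rewrite !big_split /=.
rewrite signedD; congr (_ + _).
  rewrite signed_sum; apply: eq_bigr => i _; rewrite vinv !linear_signed !signedA.
  by congr (signed _ _); bool_identity.
rewrite (eq_bigr (fun i => if (c == i) && true then signed (e && pU r) (x r a (y i s v)) else 0)); last first.
  by move=> i _; rewrite andbT.
rewrite [in RHS](eq_bigr (fun i => if (a == i) && true then
  signed (e && (pU r (+) pV a)) (x r i (y c s v)) else 0)); last first.
  by move=> i _; rewrite andbT.
rewrite !sum_if_eq !signedA; congr (signed _ _); rewrite /e; bool_identity.
Qed.

Definition isl (g : G) := if g is inl _ then true else false.
Definition isr (g : G) := ~~ isl g.
Local Notation L1 := (euler X D isl).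
Local Notation L2 := (euler X D isr).

Lemma sum_e1 v : \sum_a e1 a a v = L1 v.
Proof.
rewrite /e1 /quad exchange_big pair_bigA /euler big_sumType /=.
rewrite [X in _ = _ + X]big_pred0 // addr0; apply: eq_bigr => -[r i] _ /=.
by rewrite addbb.
Qed.

Lemma sum_e2 v : \sum_a e2 a a v = L2 v.
Proof.
rewrite /e2 /quad pair_bigA /euler big_sumType /=.
by rewrite [X in _ = X + _]big_pred0 // add0r; apply: eq_bigr => -[r i] _.
Qed.

(** Summing over E_aa gives the identity matrix, which acts by the difference of the two degrees. *)
Lemma inv_euler_eq v : inv v -> L1 v = L2 v.
Proof. by move=> vinv; rewrite -sum_e1 -sum_e2; apply: eq_bigr => a _; rewrite vinv addbb. Qed.

Lemma inv_linear k u v : inv u -> inv v -> inv (k *: u + v).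
Proof. by move=> hu hv a c; rewrite !linearP /= hu hv signedD signedZr. Qed.

Lemma inv_euler v : inv v -> inv (L1 v).
Proof.
move=> vinv a c; rewrite /e1 /e2 -!(euler_quad XX DD DX) //.
rewrite -/(e1 a c) -/(e2 c a) vinv.
exact: (linear_signed (euler X D isl)).
Qed.

(** * Coefficient kernels of a homogeneous invariant *)

Local Notation PU := (psum pU).
Local Notation PV := (psum pV).
Local Notation PW := (psum pW).

(* The signs in the four families below absorb the parities of [r] and [s], so
   that only the parities of the letters of [V] remain in [Dst_e1] and [Pst_e2].
   [Dst] and [Yst] apply their last factor first, [Xst] and [Pst] their first. *)
Fixpoint Dst (r : seq RU) (j : seq RV) (v : A) : A :=
  match r, j with
  | r1 :: r', j1 :: j' => signed (pV j1 && PU r) (dx r1 j1 (Dst r' j' v))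
  | _, _ => v
  end.

Fixpoint Xst (r : seq RU) (j : seq RV) (v : A) : A :=
  match r, j with
  | r1 :: r', j1 :: j' => signed (pV j1 && PU r) (Xst r' j' (x r1 j1 v))
  | _, _ => v
  end.

Fixpoint Pst (s : seq RW) (b : seq RV) (v : A) : A :=
  match s, b with
  | s1 :: s', b1 :: b' => signed (pV b1 && ~~ PW s) (Pst s' b' (dy b1 s1 v))
  | _, _ => v
  end.

Fixpoint Yst (s : seq RW) (b : seq RV) (v : A) : A :=
  match s, b with
  | s1 :: s', b1 :: b' => signed (pV b1 && ~~ PW s) (y b1 s1 (Yst s' b' v))
  | _, _ => v
  end.

Lemma Dst_is_linear r j : linear (Dst r j).
Proof.
elim: r j => [|r1 r IH] [|j1 j] k u v //=.
by rewrite IH linearP signedD signedZr.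
Qed.
HB.instance Definition _ r j := GRing.isLinear.Build F A A *:%R (Dst r j) (Dst_is_linear r j).

Lemma Xst_is_linear r j : linear (Xst r j).
Proof.
elim: r j => [|r1 r IH] [|j1 j] k u v //=.
by rewrite linearP IH signedD signedZr.
Qed.
HB.instance Definition _ r j := GRing.isLinear.Build F A A *:%R (Xst r j) (Xst_is_linear r j).

Lemma Pst_is_linear r j : linear (Pst r j).
Proof.
elim: r j => [|r1 r IH] [|j1 j] k u v //=.
by rewrite linearP IH signedD signedZr.
Qed.
HB.instance Definition _ r j := GRing.isLinear.Build F A A *:%R (Pst r j) (Pst_is_linear r j).

Lemma Yst_is_linear r j : linear (Yst r j).
Proof.
elim: r j => [|r1 r IH] [|j1 j] k u v //=.
by rewrite IH linearP signedD signedZr.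
Qed.
HB.instance Definition _ r j := GRing.isLinear.Build F A A *:%R (Yst r j) (Yst_is_linear r j).

Local Notation sl := (sl pV).

(** Commuting [e1 a c] past each derivative replaces one letter [a] of [j] by [c]; the twist in
    [Dst] makes these terms add up to the total action on the word [j], free of the parities of
    [r]. *)
Lemma Dst_e1 r j a c v : size r = size j ->
  Dst r j (e1 a c v)
  = signed ((pV a (+) pV c) && (PU r (+) PV j)) (e1 a c (Dst r j v))
    + \sum_(t < size j) sl t a c (fun j' => Dst r j' v) j.
Proof.
elim: r j => [|r1 r IH] [|j1 j] //= srj; first by rewrite andbF big_ord0 addr0.
case: srj => srj; rewrite IH // linearD linear_signed dx_e1 big_ord_recl /= !signedD !signedA -addrA.
congr (_ + _).
  rewrite (linear_signed (e1 a c)) !signedA; congr (signed _ _); bool_identity.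
congr (_ + _).
  rewrite signed_if signedA; case: eqP => // ->; congr (signed _ _); bool_identity.
rewrite linear_sum signed_sum; apply: eq_bigr => t _.
rewrite /bump /= sl_signed; congr (signed _ _).
by rewrite (sl_morph _ _ _ _ _ _ (linear0 (dx r1 j1)) (linearN (dx r1 j1))).
Qed.

Lemma Pst_e2 s b a c v : size s = size b ->
  Pst s b (e2 c a v)
  = signed ((pV a (+) pV c) && (PW s (+) PV b)) (e2 c a (Pst s b v))
    + signed ((pV a (+) pV c) && ~~ (pV c (+) PW s (+) PV b))
        (\sum_(t < size b) sl t c a (fun b' => Pst s b' v) b).
Proof.
elim: s b v => [|s1 s IH] [|b1 b] v //= ssb.
  by rewrite andbF big_ord0 signed0 addr0.
case: ssb => ssb; rewrite dy_e2 linearD linear_signed /= IH // big_ord_recl /=.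
rewrite !signedD !signedA -addrA; congr (_ + _).
  rewrite (linear_signed (e2 c a)) !signedA; congr (signed _ _); bool_identity.
rewrite addrC; congr (_ + _).
  rewrite (fun_if (Pst s b)) linear0 !signed_if; case: eqP => // ->.
  rewrite !signedA; congr (signed _ _); bool_identity.
rewrite signed_sum [in RHS]signed_sum; apply: eq_bigr => t _.
rewrite /bump /= sl_signed !signedA; congr (signed _ _); bool_identity.
Qed.
Lemma euler_D_eigen (Q : pred G) n g v : Q g -> euler X D Q v = n.+1%:R *: v ->
  euler X D Q (D g v) = n%:R *: D g v.
Proof.
move=> Qg Lv; have := D_euler DD DX Q g v; rewrite Lv Qg linearZ /= => h.
by apply: (addIr (D g v)); rewrite -h -natr1 scalerDl scale1r.
Qed.

Lemma euler_D_eigen0 (Q : pred G) k g v : ~~ Q g -> euler X D Q v = k *: v ->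
  euler X D Q (D g v) = k *: D g v.
Proof.
move=> /negbTE Qg Lv; have := D_euler DD DX Q g v.
by rewrite Lv Qg linearZ /= addr0 => /esym.
Qed.

Lemma signed_eigen (Q : pred G) k b v : euler X D Q v = k *: v ->
  euler X D Q (signed b v) = k *: signed b v.
Proof. by move=> Lv; rewrite (linear_signed (euler X D Q)) /= Lv signedZr. Qed.

Lemma L1_Dst n r j v : size r = size j -> L1 v = (n + size j)%:R *: v ->
  L1 (Dst r j v) = n%:R *: Dst r j v.
Proof.
elim: r j n => [|r1 r IH] [|j1 j] n //= srj; first by rewrite addn0.
case: srj => srj Lv; apply: signed_eigen; apply: euler_D_eigen => //.
by apply: IH => //; rewrite addSnnS.
Qed.

Lemma L2_Dst k r j v : L2 v = k *: v -> L2 (Dst r j v) = k *: Dst r j v.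
Proof.
move=> Lv; elim: r j => [|r1 r IH] [|j1 j] //=.
by apply: signed_eigen; apply: euler_D_eigen0.
Qed.

Lemma L2_Pst n s b v : size s = size b -> L2 v = (n + size b)%:R *: v ->
  L2 (Pst s b v) = n%:R *: Pst s b v.
Proof.
elim: s b v => [|s1 s IH] [|b1 b] v //= ssb; first by rewrite addn0.
case: ssb => ssb Lv; apply: signed_eigen; apply: IH => //; apply: euler_D_eigen => //.
by rewrite -addnS.
Qed.

Lemma L1_Pst k s b v : L1 v = k *: v -> L1 (Pst s b v) = k *: Pst s b v.
Proof.
elim: s b v => [|s1 s IH] [|b1 b] v //= Lv.
by apply: signed_eigen; apply: IH; apply: euler_D_eigen0.
Qed.

Lemma euler_D0 (Q : pred G) g v : Q g -> euler X D Q v = 0%:R *: v -> D g v = 0.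
Proof. by rewrite scale0r => Qg; apply: (euler_eq0 charF0 DD DX Dnil). Qed.

Section Component.
Variables (d : nat) (f : A).
Hypotheses (finv : inv f) (fL1 : L1 f = d%:R *: f).

Let fL2 : L2 f = d%:R *: f.
Proof. by rewrite -fL1 (inv_euler_eq finv). Qed.

(** After [d] derivatives of each kind both degrees are zero, so every further derivative
    vanishes. *)
Lemma Kconst r s j b g : size r = d -> size s = d -> size j = d -> size b = d ->
  D g (Dst r j (Pst s b f)) = 0.
Proof.
move=> sr ss sj sb; case g1: (isl g).
  apply: (euler_D0 g1); apply: L1_Dst; first by rewrite sr.
  by rewrite sj; apply: L1_Pst.
have g2 : isr g by rewrite /isr g1.
apply: (euler_D0 g2); apply: L2_Dst; apply: L2_Pst; first by rewrite ss.
by rewrite sb.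
Qed.

Lemma Pst_e1 s b a c v : size s = size b ->
  Pst s b (e1 a c v) = signed ((pV a (+) pV c) && (PW s (+) PV b)) (e1 a c (Pst s b v)).
Proof.
elim: s b v => [|s1 s IH] [|b1 b] v //= ssb; first by rewrite andbF.
case: ssb => ssb; rewrite dy_e1 linear_signed /= IH // (linear_signed (e1 a c)) /= !signedA.
by congr (signed _ _); bool_identity.
Qed.

(** Apply all derivatives to the invariance equation of [f]. The terms where [e1] or [e2] survives
    vanish by degree, and what remains are the letter substitutions in [j] and in [b]. *)
Lemma K_commutes r s a c j b : size r = d -> size s = d -> size j = d -> size b = d ->
  \sum_(t < d) sl t a c (fun j' => Dst r j' (Pst s b f)) j
  = \sum_(t < d) sl t c a (fun b' => Dst r j (Pst s b' f)) b.
Proof.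
move=> sr ss sj sb; pose e := (pV a (+) pV c) && (PW s (+) PV b).
have e1K : e1 a c (Dst r j (Pst s b f)) = 0.
  by rewrite /e1 /quad big1 // => i _; rewrite Kconst // linear0 signed0.
have e2K : e2 c a (Pst s b f) = 0.
  rewrite /e2 /quad big1 // => i _; rewrite (@euler_D0 isr) ?linear0 //.
  by apply: L2_Pst; rewrite ?sb ?ss.
apply: (@signedI _ e).
transitivity (Dst r j (Pst s b (e1 a c f))).
  by rewrite Pst_e1 ?ss ?sb // linear_signed /= Dst_e1 ?sr ?sj // e1K signed0 add0r.
rewrite finv linear_signed /= Pst_e2 ?ss ?sb // e2K signed0 add0r signedA.
rewrite linear_signed /= [in RHS]signed_sum linear_sum signed_sum /=; apply: eq_bigr => t _.
rewrite -(sl_morph _ _ _ _ _ _ (linear0 (Dst r j)) (linearN (Dst r j))).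
by congr (signed _ _); rewrite /e; bool_identity.
Qed.
End Component.

(** * Rebuilding elements from coefficients and products of pairings *)

Lemma expand_X n k : exists2 z : F, z != 0 & forall v, L1 v = (n + k)%:R *: v ->
  \sum_(r : n.-tuple RU) \sum_(j : n.-tuple RV) Xst r j (Dst r j v) = z *: v.
Proof.
elim: n k => [|n IH] k.
  exists 1; first exact: oner_neq0.
  move=> v _; rewrite (sum_tuple_nil (fun r => \sum_(j : 0.-tuple RV) Xst r j (Dst r j v))).
  by rewrite (sum_tuple_nil (fun j => Xst [::] j (Dst [::] j v))) scale1r.
(* The derivative peeled off acts last, on an element of degree [k.+1], where the Euler operator
   gives the factor [k.+1]; in total [z] is (n+k)!/k!. *)
have [z z0 zP] := IH k.+1; exists (k.+1%:R * z).
  by rewrite mulf_neq0 ?(natr_neq0 charF0).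
move=> v Lv.
rewrite (sum_tuple_cons _ (fun r => \sum_(j : n.+1.-tuple RV) Xst r j (Dst r j v))) exchange_big.
rewrite -scalerA -zP ?scaler_sumr; last by rewrite addnS -addSn.
apply: eq_bigr => r _ /=; rewrite scaler_sumr.
transitivity (\sum_r1 \sum_i \sum_(j : n.-tuple RV) Xst r j (x r1 i (dx r1 i (Dst r j v)))).
  apply: eq_bigr => r1 _.
  rewrite (sum_tuple_cons _ (fun j => Xst (r1 :: r) j (Dst (r1 :: r) j v))).
  apply: eq_bigr => i _; apply: eq_bigr => j _ /=.
  by rewrite !linear_signed signedA addbb.
rewrite pair_bigA exchange_big; apply: eq_bigr => j _ /=.
rewrite -[RHS]linearZ /= -L1_Dst ?size_tuple //; last by rewrite addSnnS addnC.
rewrite /euler big_sumType /= [X in _ + X]big_pred0 // addr0 linear_sum.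
by apply: eq_bigr => -[r1 i] _.
Qed.

Lemma expand_Y n : exists2 z : F, z != 0 & forall v, L2 v = n%:R *: v ->
  \sum_(s : n.-tuple RW) \sum_(b : n.-tuple RV) Yst s b (Pst s b v) = z *: v.
Proof.
elim: n => [|n [z z0 zP]].
  exists 1; first exact: oner_neq0.
  move=> v _; rewrite (sum_tuple_nil (fun r => \sum_(j : 0.-tuple RV) Yst r j (Pst r j v))).
  by rewrite (sum_tuple_nil (fun j => Yst [::] j (Pst [::] j v))) scale1r.
(* Here the derivative peeled off acts first, directly on [v] of degree [n.+1]; in total [z] is
   n!. *)
exists (z * n.+1%:R); first by rewrite mulf_neq0 ?(natr_neq0 charF0).
move=> v Lv; rewrite -scalerA -Lv /euler big_sumType /= [X in X + _]big_pred0 // add0r.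
rewrite [X in _ *: X](eq_bigr (fun u => y u.1 u.2 (dy u.1 u.2 v))); last by case.
rewrite -(pair_bigA _ (fun i s => y i s (dy i s v))) /= [X in _ *: X]exchange_big scaler_sumr.
rewrite (sum_tuple_cons _ (fun r => \sum_(j : n.+1.-tuple RV) Yst r j (Pst r j v))).
apply: eq_bigr => s1 _; rewrite scaler_sumr.
transitivity (\sum_(s : n.-tuple RW) \sum_b1 \sum_(b : n.-tuple RV) y b1 s1 (Yst s b (Pst s b (dy b1 s1 v)))).
  apply: eq_bigr => s _.
  rewrite (sum_tuple_cons _ (fun b => Yst (s1 :: s) b (Pst (s1 :: s) b v))).
  apply: eq_bigr => b1 _; apply: eq_bigr => b _ /=.
  by rewrite !linear_signed signedA addbb.
rewrite exchange_big; apply: eq_bigr => b1 _ /=; rewrite -linearZ /= -zP; last exact: euler_D_eigen.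
by rewrite linear_sum; apply: eq_bigr => s _; rewrite linear_sum.
Qed.

(** Multiplications supercommute, so permuting the letters of [b] amounts to permuting those of [s],
    with a sign independent of [b]. Keeping the parity of [s] lets the induction pass the twist in
    [Yst]. *)
Lemma tw_Yst n s : (n.+1 < size s)%N -> exists e s',
  [/\ size s' = size s, PW s' = PW s & forall b w, size b = size s ->
     tw pV n (fun i => Yst s i w) b = signed e (Yst s' b w)].
Proof.
elim: n s => [|n IH] [|s1 s] //=.
  case: s => [|s2 s] //= _; exists (pW s1 && pW s2), (s2 :: s1 :: s); split=> //=.
    by bool_identity.
  move=> [|b1 [|b2 b]] //= w _; rewrite !linear_signed XX !signedA; congr (signed _ _).
  by rewrite /=; bool_identity.
rewrite ltnS => /IH[e [s' [ss Ps h]]]; exists e, (s1 :: s'); split; rewrite /= ?ss ?Ps //.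
move=> [|b1 b] w //= [sb]; rewrite tw_signed.
rewrite -(tw_morph _ _ _ _ (linearN (y b1 s1))) h // linear_signed !signedA.
by congr (signed _ _); bool_identity.
Qed.

Lemma rho_Yst l s : all (fun n => n.+1 < size s)%N l -> exists e s',
  size s' = size s /\ forall b w, size b = size s ->
     rho pV l (fun i => Yst s i w) b = signed e (Yst s' b w).
Proof.
elim: l => [|n l IH] /=; first by exists false, s.
case/andP=> ns /IH[e [s' [ss h]]].
have [|e' [s'' [ss' _ h']]] := @tw_Yst n s'; first by rewrite ss.
exists (e (+) e'), s''; split=> [|b w sb]; first by rewrite ss'.
rewrite (tw_ext _ _ (v' := fun i => signed e (Yst s' i w))); last first.
  by move=> i; rewrite sb => si; rewrite h.
by rewrite tw_signed h' ?ss // signedA.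
Qed.

Fixpoint pairword (r : seq RU) (s : seq RW) (v : A) : A :=
  match r, s with
  | r1 :: r', s1 :: s' => pairop r1 s1 (pairword r' s' v)
  | _, _ => v
  end.

Lemma pairop_X r s g v :
  pairop r s (X g v) = signed ((pU r (+) pW s) && gpar g) (X g (pairop r s v)).
Proof.
rewrite /pairop linear_sum signed_sum; apply: eq_bigr => i _.
rewrite [y i s (X g v)]XX linear_signed [x r i (X g _)]XX signedA; congr (signed _ _).
by rewrite /=; bool_identity.
Qed.

Lemma pairword_X r s g v : size r = size s ->
  pairword r s (X g v) = signed ((PU r (+) PW s) && gpar g) (X g (pairword r s v)).
Proof.
elim: r s => [|r1 r IH] [|s1 s] //= srs; case: srs => srs.
rewrite IH // (linear_signed (pairop r1 s1)) /= pairop_X signedA; congr (signed _ _).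
by bool_identity.
Qed.

Lemma Yst_Xst r s : size r = size s -> exists e, forall v,
  \sum_(j : (size s).-tuple RV) Yst s j (Xst r j v) = signed e (pairword r s v).
Proof.
elim: r s => [|r1 r IH] [|s1 s] //= srs.
  by exists false => v; rewrite (sum_tuple_nil (fun j => Yst [::] j (Xst [::] j v))).
case: srs => srs; have [e eP] := IH s srs.
(* In the nested product the outermost [y] and innermost [x] share the letter [i]. Moving [x] past
   the inner pairings and then past [y] costs a sign in which the parity of [i] cancels against the
   twists. *)
exists (e (+) (pU r1 && pW s1) (+) (pU r1 && (PU r (+) PW s))) => v.
rewrite (sum_tuple_cons _ (fun j => Yst (s1 :: s) j (Xst (r1 :: r) j v))).
rewrite [pairop _ _ _]/pairop signed_sum; apply: eq_bigr => i _.
transitivity (signed ((pV i && ~~ (pW s1 (+) PW s)) (+) (pV i && (pU r1 (+) PU r)))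
   (y i s1 (\sum_(j : (size s).-tuple RV) Yst s j (Xst r j (x r1 i v))))).
  rewrite linear_sum signed_sum; apply: eq_bigr => j _ /=.
  by rewrite !linear_signed signedA.
rewrite eP pairword_X // !linear_signed !signedA XX signedA; congr (signed _ _).
by rewrite /=; bool_identity.
Qed.

Variable vac : A.
Hypothesis constants : forall v, (forall g, D g v = 0) -> exists k, v = k *: vac.

(** [T] is any subspace containing the vacuum and stable under the pairings; later it is membership
    in the generated subalgebra. *)
Lemma inv_in_span (T : A -> Prop) : T vac -> (forall k u v, T u -> T v -> T (k *: u + v)) ->
  (forall r s v, T v -> T (pairop r s v)) -> forall f, inv f -> T f.
Proof.
move=> T1 Tlin Tpair.
have T0 : T 0 by rewrite -[0](addNr vac) -scaleN1r; apply: Tlin.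
have TZ k u : T u -> T (k *: u) by move=> Tu; rewrite -[_ *: _]addr0; apply: Tlin.
have TD u v : T u -> T v -> T (u + v) by move=> Tu Tv; rewrite -[u]scale1r; apply: Tlin.
have Tsum (I : finType) (h : I -> A) : (forall i, T (h i)) -> T (\sum_i h i).
  by move=> Th; apply: big_ind.
have Tsigned b u : T u -> T (signed b u).
  by case: b => //= Tu; rewrite -scaleN1r; apply: TZ.
apply: (euler_components charF0 DD DX Dnil (Q := isl) inv_linear inv_euler Tlin) => d f finv fL1.
have fL2 : L2 f = d%:R *: f by rewrite -fL1 (inv_euler_eq finv).
have [z1 z1n0 z1P] := expand_Y d; have [z2 z2n0 z2P] := expand_X d 0.
(* Both constants are inverted, so [f] is rebuilt from its coefficients, first in the [y] and then
   in the [x] generators. *)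
have -> : f = (z2 * z1)^-1 *: (z2 *: (z1 *: f)) 
  by rewrite !scalerA -?mulrA mulVf ?scale1r // mulf_neq0.
apply: (TZ); rewrite -z1P // scaler_sumr; apply: (Tsum) => s; rewrite scaler_sumr.
rewrite (eq_bigr (fun b : d.-tuple RV => \sum_(r : d.-tuple RU) \sum_(j : d.-tuple RV)
   Yst s b (Xst r j (Dst r j (Pst s b f))))); last first.
  move=> b _; rewrite -linearZ /= -z2P; last by rewrite addn0; apply: L1_Pst.
  by rewrite linear_sum; apply: eq_bigr => r _; rewrite linear_sum.
rewrite exchange_big; apply: (Tsum) => r.
have [|I [l [H [ld HK KE]]]] := @commuting_kernel_span _ pV F A d
  (fun j b => Dst r j (Pst s b f)) charF0.
  by move=> a c j b sj sb; apply: (K_commutes finv fL1); rewrite ?size_tuple.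
rewrite exchange_big (eq_bigr (fun j : d.-tuple RV => \sum_i \sum_(b : d.-tuple RV)
   (rcoef pV (l i) b j)%:~R *: Yst s b (Xst r j (H i)))) /=; last first.
  move=> j _; rewrite exchange_big; apply: eq_bigr => b _ /=.
  rewrite KE !linear_sum; apply: eq_bigr => i _ /=.
  by rewrite [Xst _ _ _]linearZ [LHS]linearZ.
rewrite exchange_big; apply: (Tsum) => i /=.
(* Summing over [b] applies the transposed permutation to the words of [Yst], which is absorbed by
   reordering [s] into [s']. *)
have [|e [s' [ss' s'P]]] := @rho_Yst (rev (l i)) s; first by rewrite all_rev size_tuple.
rewrite (eq_bigr (fun j : d.-tuple RV => signed e (Yst s' j (Xst r j (H i))))); last first.
  move=> j _; rewrite -s'P ?size_tuple // (rho_coef _ _ _ (size_tuple j)).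
  by apply: eq_bigr => b _; rewrite (@rcoef_rev _ _ d) ?size_tuple.
rewrite -signed_sum; apply: (Tsigned).
have [|e' ] := @Yst_Xst r s'; first by rewrite ss' !size_tuple.
rewrite ss' size_tuple => ->; apply: (Tsigned).
(* [H i] is a combination of entries of the kernel, which are killed by all derivatives. *)
have [k ->] : exists k, H i = k *: vac.
  apply: constants => g; have [k ->] := HK i.
  rewrite linear_sum big1 // => j _; rewrite linear_sum big1 // => b _.
  by rewrite linearZ /= (Kconst finv fL1) ?size_tuple // scaler0.
elim: (tval r) s' {ss' s'P} => [|r1 r' IHr] [|s1 s'] /=; try exact: TZ.
by apply: Tpair.
Qed.
End Invariants.

(** * The free supercommutative algebra *)

Section SuperAlgebra.
Variables (F : fieldType) (G : finType) (par : G -> bool).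
Local Notation Ev := {x : G | ~~ par x}.
Local Notation Od := {x : G | par x}.
Local Notation A := {ffun {set Od} -> {mpoly F[#|{: Ev}|]}}.
Implicit Types (f g h : A) (S B C : {set Od}) (o : Od) (e : Ev).

Lemma sa_addE f g : sa_add f g = f + g :> A.
Proof. by apply/ffunP => S; rewrite !ffunE. Qed.
Lemma sa_scaleE c f : sa_scale c f = c *: f :> A.
Proof. by apply/ffunP => S; rewrite !ffunE. Qed.
Lemma sa_zeroE : sa_zero F par = 0 :> A.
Proof. by apply/ffunP => S; rewrite !ffunE. Qed.
Lemma sa_sumE (I : finType) (k : I -> A) : sa_sum k = \sum_i k i :> A.
Proof.
apply: (big_rec2 (fun u v : A => u = v)) => [|i u v _ ->]; first exact: sa_zeroE.
exact: sa_addE.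
Qed.

Lemma sa_addS f g S : (f + g) S = f S + g S.
Proof. by rewrite ffunE. Qed.
Lemma sa_scaleS c f S : (c *: f) S = c *: f S.
Proof. by rewrite ffunE. Qed.
Lemma sa_zeroS S : (0 : A) S = 0.
Proof. by rewrite ffunE. Qed.
Lemma sa_oppS f S : (- f) S = - f S.
Proof. by rewrite ffunE. Qed.

Lemma scale_signr (M : lmodType F) n (v : M) : (-1) ^+ n *: v = signed (odd n) v.
Proof. by rewrite -signr_odd; case: (odd n); rewrite ?expr0 ?expr1 ?scale1r ?scaleN1r. Qed.

(** Only parities of inversion counts enter the signs; as exclusive-or sums they are additive over
    disjoint unions. *)
Definition rk S o : bool := \big[addb/false]_(b in S) ltO b o.
Definition inversions B C : bool := \big[addb/false]_(a in B) rk C a.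

Lemma odd_rk S o : odd #|[set b in S | ltO b o]| = rk S o.
Proof.
rewrite /rk -sum1_card (big_morph odd oddD (erefl : odd 0 = false)).
rewrite [LHS]big_mkcond [RHS]big_mkcond.
by apply: eq_bigr => b _; rewrite inE; case: (_ \in _); case: ltO.
Qed.

Lemma odd_inversions B C : odd (\sum_(a in B) #|[set b in C | ltO b a]|) = inversions B C.
Proof.
rewrite (big_morph odd oddD (erefl : odd 0 = false)).
by apply: eq_bigr => a _; apply: odd_rk.
Qed.

Lemma rkU S B o : [disjoint S & B] -> rk (S :|: B) o = rk S o (+) rk B o.
Proof. by move=> SB; rewrite /rk -(bigU _ _ _ SB); apply: eq_bigl => b; rewrite !inE. Qed.

Lemma inversionsUl B1 B2 C : [disjoint B1 & B2] ->
  inversions (B1 :|: B2) C = inversions B1 C (+) inversions B2 C.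
Proof. by move=> dB; rewrite /inversions -(bigU _ _ _ dB); apply: eq_bigl => b; rewrite !inE. Qed.

Lemma inversionsUr B C1 C2 : [disjoint C1 & C2] ->
  inversions B (C1 :|: C2) = inversions B C1 (+) inversions B C2.
Proof.
move=> dC; rewrite /inversions -big_split; apply: eq_bigr => a _; exact: rkU.
Qed.

Lemma setUD_sub B S : B \subset S -> B :|: (S :\: B) = S.
Proof.
move=> /subsetP BS; apply/setP => b; rewrite !inE.
by case: (boolP (b \in B)) => //= /BS.
Qed.

Lemma disjoint_setDr B S : [disjoint B & S :\: B].
Proof. by rewrite disjoints_subset setCD subsetUr. Qed.

Lemma sa_mulE f g S : sa_mul f g S
  = \sum_(B : {set Od} | B \subset S) signed (inversions B (S :\: B)) (f B * g (S :\: B)).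
Proof.
rewrite ffunE [RHS]big_mkcond; apply: eq_bigr => B _.
case: ifP => BS; last first.
  apply: big1 => C /andP[_ /eqP SE]; move: BS.
  by rewrite -SE subsetUl.
rewrite (big_pred1 (S :\: B)) => [|C]; first by rewrite scale_signr odd_inversions.
apply/andP/eqP => [[dBC /eqP <-]|->].
  by rewrite setDUl setDv set0U; apply/esym/setDidPl; rewrite disjoint_sym.
by rewrite disjoint_setDr setUD_sub.
Qed.

(** Both sides run over the ordered partitions of [S] into three sets, and the signs agree by
    additivity of [inversions] in each argument. *)
Lemma sa_mulA f g h : sa_mul f (sa_mul g h) = sa_mul (sa_mul f g) h.
Proof.
apply/ffunP => S; rewrite !sa_mulE.
transitivity (\sum_(B : {set Od}) \sum_(C : {set Od} | (C \subset S) && (B \subset C))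
  signed (inversions C (S :\: C)) (signed (inversions B (C :\: B))
    (f B * g (C :\: B) * h (S :\: C)))); last first.
  rewrite (exchange_big_dep (fun C => C \subset S)) /=; last by move=> B C _ /andP[].
  apply: eq_bigr => C CS; rewrite sa_mulE mulr_suml signed_sum.
  rewrite [RHS]big_mkcond [LHS]big_mkcond; apply: eq_bigr => B _ /=; rewrite CS /=.
  by case: ifP => // _; case: (inversions B _); rewrite //= mulNr.
rewrite big_mkcond; apply: eq_bigr => B _; case: ifP => BS; last first.
  rewrite big_pred0 // => C; apply/negbTE/negP => /andP[CS /subset_trans /(_ CS)].
  by rewrite BS.
rewrite (reindex_onto (fun C => B :|: C) (fun C => C :\: B)) /=; last first.
  by move=> C /andP[_ BC]; rewrite setUD_sub.
rewrite sa_mulE mulr_sumr signed_sum; apply: eq_big => [C|C CSB].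
  rewrite subUset BS subsetUl andbT /= setDUl setDv set0U subsetD; congr (_ && _).
  by apply/idP/eqP => /setDidPl.
have /andP[CS dCB] : (C \subset S) && [disjoint C & B] by rewrite -subsetD.
have -> : (B :|: C) :\: B = C by rewrite setDUl setDv set0U; apply/setDidPl.
rewrite -setDDl inversionsUl; last by rewrite disjoint_sym.
have {1}-> : S :\: B = C :|: (S :\: B :\: C).
  by rewrite setUD_sub.
rewrite inversionsUr ?disjoint_setDr //.
rewrite -mulrA signedA; set u := f B; set v := g C; set w := h _.
have -> : u * signed (inversions C (S :\: B :\: C)) (v * w)
  = signed (inversions C (S :\: B :\: C)) (u * (v * w)) by case: inversions; rewrite //= mulrN.
by rewrite signedA; congr (signed _ _); bool_identity.
Qed.

Lemma inversions0l C : inversions set0 C = false.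
Proof. by rewrite /inversions big_set0. Qed.
Lemma inversions0r B : inversions B set0 = false.
Proof. by rewrite /inversions big1 // => b _; rewrite /rk big_set0. Qed.

Lemma sa_mul1l f : sa_mul (sa_one F par) f = f.
Proof.
apply/ffunP => S; rewrite sa_mulE (bigD1 set0) ?sub0set //= big1 => [|B /andP[_ Bn0]].
  by rewrite ffunE eqxx mul1r setD0 inversions0l addr0.
by rewrite ffunE (negbTE Bn0) mul0r signed0.
Qed.

Lemma sa_mul1r f : sa_mul f (sa_one F par) = f.
Proof.
apply/ffunP => S; rewrite sa_mulE (bigD1 S) //= big1 => [|B /andP[BS BnS]].
  by rewrite ffunE setDv eqxx mulr1 inversions0r addr0.
rewrite ffunE setD_eq0; case: ifP => [SB|_]; last by rewrite mulr0 signed0.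
by case/negP: BnS; rewrite eqEsubset BS SB.
Qed.

Lemma sa_mul_linear f : linear (sa_mul f : A -> A).
Proof.
move=> c g h; apply/ffunP => S; rewrite sa_addS sa_scaleS !sa_mulE scaler_sumr -big_split.
apply: eq_bigr => B _ /=; rewrite sa_addS sa_scaleS mulrDr signedD signedZr.
by rewrite scalerAr.
Qed.

Lemma sa_mulDl f g h : sa_mul (f + g) h = sa_mul f h + sa_mul g h :> A.
Proof.
apply/ffunP => S; rewrite sa_addS !sa_mulE -big_split.
by apply: eq_bigr => B _ /=; rewrite sa_addS mulrDl signedD.
Qed.

Lemma sa_mulZl c f g : sa_mul (c *: f) g = c *: sa_mul f g :> A.
Proof.
apply/ffunP => S; rewrite sa_scaleS !sa_mulE scaler_sumr.
by apply: eq_bigr => B _ /=; rewrite sa_scaleS -scalerAl signedZr.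
Qed.

Definition sa_X (x : G) : A -> A := sa_mul (sa_var F par x).
Definition sa_D (x : G) : A -> A := @sa_deriv F G par x.

Lemma gen_cases x : (exists e, x = val e) \/ (exists o, x = val o).
Proof.
case: (boolP (par x)) => px; first by right; exists (exist _ x px).
by left; exists (exist _ x px).
Qed.

Lemma par_Ev e : par (val e) = false. Proof. exact: negbTE (valP e). Qed.
Lemma par_Od o : par (val o). Proof. exact: valP o. Qed.
Lemma insub_Od o : insub (val o) = None :> option Ev.
Proof. by rewrite insubN // negbK; apply: par_Od. Qed.

Lemma sa_X_Ev e f S : sa_X (val e) f S = 'X_(enum_rank e) * f S.
Proof.
rewrite /sa_X /sa_var valK sa_mulE (bigD1 set0) ?sub0set //= big1 => [|B /andP[_ Bn0]].
  by rewrite ffunE eqxx setD0 inversions0l addr0.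
by rewrite ffunE (negbTE Bn0) mul0r signed0.
Qed.

Lemma ltO_irr o : ltO o o = false. Proof. exact: ltnn. Qed.

Lemma rkD1 S o o' : rk (S :\ o') o = rk S o (+) ((o' \in S) && ltO o' o).
Proof.
rewrite /rk; case: (boolP (o' \in S)) => oS; last first.
  by rewrite addbF; apply: eq_bigl => b; rewrite !inE; case: eqP => // ->; rewrite (negbTE oS).
by rewrite [in RHS](big_setD1 _ oS) /= addbC addbA addbb.
Qed.

Lemma rkU1 S o o' : o' \notin S -> rk (o' |: S) o = ltO o' o (+) rk S o.
Proof. by move=> oS; rewrite /rk big_setU1. Qed.

Lemma sa_X_Od o f S : sa_X (val o) f S = if o \in S then signed (rk S o) (f (S :\ o)) else 0.
Proof.
rewrite /sa_X /sa_var insub_Od valK sa_mulE.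
have E B : B != [set o] -> signed (inversions B (S :\: B)) ([ffun S0 : {set Od} =>
   if S0 == [set o] then 1 else 0] B * f (S :\: B)) = 0.
  by move=> Bo; rewrite ffunE (negbTE Bo) mul0r signed0.
case: ifP => oS; last first.
  apply: big1 => B BS; apply: E; apply: contraFneq oS => Bo.
  by rewrite -sub1set -Bo.
rewrite (bigD1 [set o]) ?sub1set //= big1 => [|B /andP[_]]; last exact: E.
by rewrite ffunE eqxx mul1r addr0 /inversions big_set1 rkD1 ltO_irr andbF addbF.
Qed.

Lemma sa_D_Ev e f S : sa_D (val e) f S = mderiv (enum_rank e) (f S).
Proof. by rewrite /sa_D /sa_deriv valK ffunE. Qed.

Lemma sa_D_Od o f S :
  sa_D (val o) f S = if o \in S then 0 else signed (rk S o) (f (o |: S)).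
Proof.
rewrite /sa_D /sa_deriv insub_Od valK ffunE; case: ifP => // _.
by rewrite scale_signr odd_rk.
Qed.

Lemma ltO_neq o o' : o != o' -> ltO o o' = ~~ ltO o' o.
Proof.
move=> ne; rewrite /ltO -leqNgt ltn_neqAle; case: eqP => //= /val_inj/enum_rank_inj E.
by rewrite E eqxx in ne.
Qed.

Lemma sa_XX x x' f : sa_X x (sa_X x' f) = signed (par x && par x') (sa_X x' (sa_X x f)).
Proof.
case: (gen_cases x) => -[u ->]; case: (gen_cases x') => -[u' ->]; apply/ffunP => S.
- by rewrite par_Ev /= !sa_X_Ev mulrCA.
- rewrite par_Ev /= sa_X_Ev !sa_X_Od (fun_if (fun v => _ * v)) mulr0 sa_X_Ev.
  by case: ifP => // _; case: rk; rewrite //= mulrN.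
- rewrite par_Ev andbF /= sa_X_Ev !sa_X_Od (fun_if (fun v => _ * v)) mulr0 sa_X_Ev.
  by case: ifP => // _; case: rk; rewrite //= mulrN.
rewrite !par_Od /= sa_oppS !sa_X_Od !inE.
case: (eqVneq u u') => [->|ne] /=; first by rewrite ?eqxx /= signed0 if_same oppr0.
rewrite ?(eq_sym u') ?ne /= !rkD1 (ltO_neq ne).
case: (u \in S) (u' \in S) => [] [] /=; rewrite ?signed0 ?oppr0 //.
rewrite !signedA setDDl [in RHS]setDDl setUC -[LHS]opprK; congr (- _).
by rewrite -[- _]/(signed true _) signedA; congr (signed _ _); bool_identity.
Qed.

Lemma sa_DD x x' f : sa_D x (sa_D x' f) = signed (par x && par x') (sa_D x' (sa_D x f)).
Proof.
case: (gen_cases x) => -[u ->]; case: (gen_cases x') => -[u' ->]; apply/ffunP => S.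
- by rewrite par_Ev /= !sa_D_Ev mderiv_comm.
- rewrite par_Ev /= sa_D_Ev !sa_D_Od (fun_if (mderiv _)) mderiv0 sa_D_Ev.
  by case: ifP => // _; case: rk; rewrite //= mderivN.
- rewrite par_Ev andbF /= sa_D_Ev !sa_D_Od (fun_if (mderiv _)) mderiv0 sa_D_Ev.
  by case: ifP => // _; case: rk; rewrite //= mderivN.
rewrite !par_Od /= sa_oppS !sa_D_Od !inE.
case: (eqVneq u u') => [->|ne] /=; first by rewrite ?eqxx /= signed0 if_same oppr0.
rewrite ?(eq_sym u') ?(negbTE ne) /=.
case: (boolP (u \in S)) => uS; case: (boolP (u' \in S)) => u'S /=; rewrite ?signed0 ?oppr0 //.
rewrite !rkU1 // (ltO_neq ne) !signedA setUCA -[LHS]opprK; congr (- _).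
by rewrite -[- _]/(signed true _) signedA; congr (signed _ _); bool_identity.
Qed.

Lemma sa_DX x x' f : sa_D x (sa_X x' f)
  = (if x == x' then f else 0) + signed (par x && par x') (sa_X x' (sa_D x f)).
Proof.
case: (gen_cases x) => -[u ->]; case: (gen_cases x') => -[u' ->]; apply/ffunP => S.
- rewrite par_Ev /= sa_D_Ev sa_addS !sa_X_Ev sa_D_Ev mderivM; congr (_ + _).
  rewrite mderivX mnm1E val_eqE; case: (eqVneq u u') => [->|ne].
    set m := U_(_)%MM; have -> : (m - m = 0)%MM by rewrite -{1}[m]add0m addmK.
    by rewrite eqxx mpolyX0 scale1r mul1r.
  by rewrite (inj_eq enum_rank_inj) eq_sym (negbTE ne) scale0r mul0r ffunE.
- rewrite par_Ev /=; case: eqP => [E|_]; first by have := par_Od u'; have := par_Ev u; rewrite /= E => ->.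
  rewrite add0r sa_D_Ev !sa_X_Od (fun_if (mderiv _)) mderiv0 sa_D_Ev.
  by case: ifP => // _; case: rk; rewrite //= mderivN.
- rewrite par_Ev andbF /=; case: eqP => [E|_]; first by have := par_Od u; have := par_Ev u'; rewrite /= E => ->.
  rewrite add0r sa_X_Ev !sa_D_Od (fun_if (fun v => _ * v)) mulr0 sa_X_Ev.
  by case: ifP => // _; case: rk; rewrite //= mulrN.
rewrite !par_Od sa_addS sa_oppS sa_D_Od !sa_X_Od sa_D_Od !inE val_eqE.
(* For one and the same odd generator, the coefficient at [S] comes only from [X D] if [u] is in [S]
   and only from [D X] otherwise. *)
case: (eqVneq u u') => [<-|ne] /=.
  rewrite ?eqxx /=; case: (boolP (u \in S)) => uS.
    by rewrite signedA rkD1 ltO_irr andbF addbF addbb /= setD1K // subrr.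
  by rewrite signedA rkU1 // ltO_irr addbb /= setU1K // oppr0 addr0.
rewrite sa_zeroS add0r ?(eq_sym u') ?(negbTE ne) /=.
case: (boolP (u \in S)) => uS; case: (boolP (u' \in S)) => u'S /=; rewrite ?signed0 ?oppr0 //.
rewrite rkU1 // rkD1 u'S (ltO_neq ne) !signedA.
have -> : u |: S :\ u' = (u |: S) :\ u'.
  apply/setP => b; rewrite !inE; case: (eqVneq b u) => // ->.
  by rewrite ne.
rewrite -[LHS]opprK; congr (- _).
by rewrite -[- _]/(signed true _) signedA; congr (signed _ _); bool_identity.
Qed.

Lemma sa_mul0l g : sa_mul (0 : A) g = 0.
Proof. by rewrite -[X in sa_mul X g](scale0r (0 : A)) sa_mulZl scale0r. Qed.

Lemma sa_suml (I : finType) (k : I -> A) g :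
  sa_mul (\sum_i k i) g = \sum_i (sa_mul (k i) g : A).
Proof.
apply: (big_morph (fun u : A => sa_mul u g : A)) => [u v|]; first exact: sa_mulDl.
exact: sa_mul0l.
Qed.

HB.instance Definition _ x := GRing.isLinear.Build F A A *:%R (sa_X x)
  (sa_mul_linear (sa_var F par x)).

Lemma sa_D_linear x : linear (sa_D x).
Proof.
move=> c f g; apply/ffunP => S; rewrite sa_addS sa_scaleS.
case: (gen_cases x) => -[u ->].
  by rewrite !sa_D_Ev sa_addS sa_scaleS mderivD mderivZ.
rewrite !sa_D_Od sa_addS sa_scaleS; case: ifP => _; first by rewrite scaler0 addr0.
by rewrite signedD signedZr.
Qed.
HB.instance Definition _ x := GRing.isLinear.Build F A A *:%R (sa_D x) (sa_D_linear x).

Definition Xlin x : {linear A -> A} := sa_X x.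
Definition Dlin x : {linear A -> A} := sa_D x.

(** Each derivative lowers the total degree, polynomial degree plus number of odd generators. The
    bound is strict, so at [n = 0] it forces the element to be zero. *)
Lemma sa_D_nilpotent f : exists n, forall w, size w = n -> Dword Dlin w f = 0.
Proof.
pose bounded n (g : A) := forall S m, (g S)@_m != 0 -> (mdeg m + #|S| < n)%N.
have [n fn] : exists n, bounded n f.
  exists (\sum_S (msize (f S) + #|S|))%N => S m; rewrite -mcoeff_msupp => /msize_mdeg_lt.
  rewrite (bigD1 S) //= => h; apply: leq_trans (leq_addr _ _).
  by rewrite -addSn leq_add2r.
exists n => w; elim: w n f fn => [|x w IH] [|n] f fn //= => [_|[sw]].
  apply/ffunP => S; rewrite sa_zeroS; apply/mpolyP => m; rewrite mcoeff0.
  by apply/eqP/negP => /negP /fn.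
apply: (IH n) => // S m; rewrite /Dlin /=; case: (gen_cases x) => -[u ->].
  rewrite sa_D_Ev mcoeff_deriv => h.
  have /fn : (f S)@_(m + U_(enum_rank u)) != 0.
    by apply: contraNneq h => ->; rewrite mul0rn.
  by rewrite mdegD mdeg1 addn1 addSn ltnS.
rewrite sa_D_Od; case: (boolP (u \in S)) => uS; first by rewrite mcoeff0 eqxx.
move=> h; have /fn : (f (u |: S))@_m != 0.
  by move: h; case: rk; rewrite //= mcoeffN oppr_eq0.
by rewrite cardsU1 uS addnCA add1n ltnS.
Qed.

Lemma sa_constants f : [pchar F] =i pred0 ->
  (forall x, Dlin x f = 0) -> exists c, f = c *: (sa_one F par : A).
Proof.
move=> charF0 f0; exists (f set0)@_0; apply/ffunP => S; rewrite sa_scaleS ffunE.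
case: eqP => [->|/eqP/set0Pn[o oS]]; last first.
  have := congr1 (fun g : A => g (S :\ o)) (f0 (val o)).
  rewrite sa_zeroS /Dlin /= sa_D_Od !inE eqxx /= setD1K // scaler0.
  by case: rk => //= /eqP; rewrite oppr_eq0 => /eqP.
apply/mpolyP => m; rewrite mcoeffZ mcoeff1.
have [->|mn0] := eqVneq m 0%MM; first by rewrite mulr1.
have [i mi] : exists i, m i != 0%N.
  apply/existsP; apply: contraNT mn0; rewrite negb_exists => /forallP m0.
  by apply/eqP/mnmP => i; rewrite mnm0E; apply/eqP; rewrite -[_ == _]negbK m0.
(* This coefficient of the derivative is that of [m] times the exponent of the [i]-th variable,
   invertible in characteristic zero. *)
have := congr1 (fun g : A => (g set0)@_(m - U_(i))%MM) (f0 (val (enum_val i))).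
rewrite sa_zeroS /Dlin /= sa_D_Ev enum_valK mcoeff0 mcoeff_deriv submK ?lep1mP //.
move/eqP; rewrite -[_ *+ _.+1]mulr_natr mulf_eq0.
by move/pcharf0P: charF0 => ->; rewrite orbF mulr0 => /eqP.
Qed.
End SuperAlgebra.

(** * Invariants of gl(V) in the concrete algebra *)

Section FirstFundamentalTheorem.
Variables (F : fieldType) (k l n m p q : nat).
Hypothesis charF0 : [pchar F] =i pred0.
Local Notation par := (@Apar k l n m p q).
Local Notation A := (Aalg F k l n m p q).
Local Notation X := (@Xlin F (Agen k l n m p q) par).
Local Notation D := (@Dlin F (Agen k l n m p q) par).
Local Notation pU := (@spar k l).
Local Notation pV := (@spar n m).
Local Notation pW := (@spar p q).
Implicit Types (f g : A).

Lemma sgnFE (M : lmodType F) b (v : M) : sgnF F b *: v = signed b v.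
Proof. by case: b; rewrite /= ?scaleN1r ?scale1r. Qed.

Lemma sum_if_eqr (M : zmodType) (I : finType) (i0 : I) (h : I -> M) :
  \sum_i (if i == i0 then h i else 0) = h i0.
Proof. by rewrite -big_mkcond big_pred1_eq. Qed.

(** Of the derivation defined by [Erho] only the generators with V-index [b] in the first factor and
    [a] in the second contribute; the minus sign is that of the dual action. *)
Lemma EactE (a b : RV n m) f :
  Eact a b f = e1 pU pV X D a b f - signed ((pV a (+) pV b) && pV a) (e2 X D b a f) :> SA F par.
Proof.
rewrite /Eact /sa_der sa_sumE big_sumType; congr (_ + _).
  transitivity (\sum_r \sum_i (sa_mul (Erho F a b (inl (r, i))) (sa_deriv (inl (r, i)) f) : SA F par)).
    by rewrite pair_bigA; apply: eq_bigr => -[].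
  apply: eq_bigr => r _.
  rewrite -(sum_if_eqr b (fun i => signed _ (X (inl (r, a)) (D (inl (r, i)) f)))).
  apply: eq_bigr => i _ /=; case: eqP => [->|_]; last by rewrite sa_zeroE sa_mul0l.
  by rewrite sa_scaleE sa_mulZl sgnFE.
transitivity (\sum_s \sum_i (sa_mul (Erho F a b (inr (i, s))) (sa_deriv (inr (i, s)) f) : SA F par)).
  by rewrite exchange_big pair_bigA; apply: eq_bigr => -[].
rewrite /e2 /quad signed_sum -sumrN; apply: eq_bigr => s _.
rewrite -(sum_if_eqr a (fun i => - signed _ (X (inr (b, s)) (D (inr (i, s)) f)))).
apply: eq_bigr => i _ /=; case: eqP => [->|_]; last by rewrite sa_zeroE sa_mul0l.
by rewrite sa_scaleE sa_mulZl scaleNr sgnFE.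
Qed.

Lemma gl_invariantP f : gl_invariant f <-> inv pU pV X D f.
Proof.
split=> [h a c|h Y].
  have := h (fun a' c' => ((a', c') == (a, c))%:R); rewrite /glact sa_sumE (bigD1 (a, c)) //= big1.
    rewrite addr0 eqxx sa_scaleE scale1r EactE sa_zeroE => /eqP.
    by rewrite subr_eq0 => /eqP.
  by move=> [a' c'] /negbTE /= ->; rewrite sa_scaleE scale0r.
rewrite /glact sa_sumE sa_zeroE big1 // => -[a c] _ /=.
by rewrite sa_scaleE EactE h subrr scaler0.
Qed.

Lemma pairing_mul r s f : sa_mul (pairing F n m r s) f = pairop X r s f.
Proof.
rewrite /pairing sa_sumE sa_suml; apply: eq_bigr => i _.
by rewrite -sa_mulA.
Qed.

Let XX x y (v : SA F par) : X x (X y v) = signed (gpar pU pV pW x && gpar pU pV pW y) (X y (X x v)).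
Proof. exact: sa_XX. Qed.
Let DD x y (v : SA F par) : D x (D y v) = signed (gpar pU pV pW x && gpar pU pV pW y) (D y (D x v)).
Proof. exact: sa_DD. Qed.
Let DX x y (v : SA F par) : D x (X y v)
  = (if x == y then v else 0) + signed (gpar pU pV pW x && gpar pU pV pW y) (X y (D x v)).
Proof. exact: sa_DX. Qed.

(** Phrased for multiplication by [f] on all invariants, so that products become compositions of
    operators. *)
Lemma generated_mul_inv f : sa_generated (fun rs : RU k l * RW p q => pairing F n m rs.1 rs.2) f ->
  forall g, inv pU pV X D g -> inv pU pV X D (sa_mul f g).
Proof.
elim=> {f} [[r s]|//|f f' _ IH _ IH'|c f _ IH|f f' _ IH _ IH'] g ginv.
- by rewrite pairing_mul; apply: (inv_pairop XX DX).
- by rewrite sa_mul1l.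
- by rewrite sa_addE sa_mulDl -[sa_mul f g]scale1r; apply: inv_linear; [apply: IH|apply: IH'].
(* The zero needed by [inv_linear] is written as [- g + g], with [g] a known invariant. *)
- rewrite sa_scaleE sa_mulZl -[_ *: _]addr0 -(addNr g) -scaleN1r.
  by do 2?[apply: inv_linear => //]; apply: IH.
- by rewrite -sa_mulA; apply: IH; apply: IH'.
Qed.

Lemma inv_generated f : inv pU pV X D f ->
  sa_generated (fun rs : RU k l * RW p q => pairing F n m rs.1 rs.2) f.
Proof.
apply: (inv_in_span charF0 XX DD DX (@sa_D_nilpotent _ _ par)
  (fun v => @sa_constants _ _ par v charF0)).
- exact: sgen_one.
- move=> c u v gu gv; rewrite -sa_scaleE -sa_addE.
  by apply: sgen_add => //; apply: sgen_scale.
- move=> r s v gv; rewrite -pairing_mul.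
  by apply: sgen_mul => //; apply: (sgen_gen _ (r, s)).
Qed.

Lemma inv_one : inv pU pV X D (sa_one F par).
Proof.
have D1 x : D x (sa_one F par) = 0.
  apply/ffunP => S; rewrite sa_zeroS /Dlin /=; case: (gen_cases par x) => -[u ->].
    by rewrite sa_D_Ev ffunE; case: ifP; rewrite ?mderiv0 // -mpolyC1 mderivC.
  rewrite sa_D_Od ffunE; case: ifP => // _.
  by rewrite -subset0 subUset sub1set inE signed0.
move=> a c; rewrite /e1 /e2 /quad !big1 ?signed0 // => i _; by rewrite D1 linear0 ?signed0.
Qed.
End FirstFundamentalTheorem.

Theorem theorem2p1 (F : fieldType) (charF0 : [pchar F]%R =i pred0)
    (k l n m p q : nat) (f : Aalg F k l n m p q) :
  gl_invariant f <->
  sa_generated (fun rs : RU k l * RW p q => pairing F n m rs.1 rs.2) f.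
Proof.
rewrite gl_invariantP; split; first exact: inv_generated.
by move=> /generated_mul_inv/(_ _ (@inv_one F k l n m p q)); rewrite sa_mul1r.
Qed.
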